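(* Let $(C_\gamma)_{\gamma>0}$ be positive constants diverging logarithmically as $\gamma\to0$, let $b_\gamma>0$ with $b_\gamma\to b\in(0,\infty)$ as $\gamma\to0$, and let $n\ge2$, $m\ge1$ be integers. Let $\mathfrak a_1,\mathfrak a_3,\dots,\mathfrak a_{2n-1}\in\mathbb R$ with $\mathfrak a_{2n-1}<0$ small enough in absolute value. Then there exist $\gamma_0>0$ and a family $\{\mu_\gamma\}_{0<\gamma<\gamma_0}$ of rotation-invariant probability measures on $\mathbb R^m$ such that: (i) for every $\gamma<\gamma_0$, $\mu_\gamma$ has all exponential moments, i.e. $\int e^{\theta|\eta|}\mu_\gamma(d\eta)<\infty$ for all $\theta>0$; (ii) $\mu_\gamma$ converges weakly as $\gamma\to0$; (iii) for every $\gamma<\gamma_0$ and every $j=1,\dots,m$, the polynomial $\tilde{\mathfrak p}_\gamma^{(j)}$ on $\mathbb R^m$ associated (see context) with the measure $\mu_\gamma$ and the inverse temperature $b_\gamma$ is $$\tilde{\mathfrak p}^{(j)}_\gamma(X)=\mathfrak a_1X^{(j)}+\mathfrak a_3H(X^{(j)}|X|^2,C_\gamma)+\dots+\mathfrak a_{2n-1}H(X^{(j)}|X|^{2n-2},C_\gamma).$$ Moreover, the family $\{\mu_\gamma\}$ can be chosen so that all $\mu_\gamma$ are supported in the same compact subset of $\mathbb R^m$.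
   Context: ''Diverging logarithmically'' means that there are constants $0<c\le c'$ with $c\log(\gamma^{-1})\le C_\gamma\le c'\log(\gamma^{-1})$ for all small $\gamma$. For a polynomial $q$ on $\mathbb R^m$ and $c\in\mathbb R$, $H(q,c)=e^{-\frac c2\Delta}q=\sum_{l\ge0}\frac{(-c/2)^l}{l!}\Delta^lq$ (a finite sum), $\Delta$ being the Laplacian on $\mathbb R^m$; $X^{(j)}$ denotes the $j$-th coordinate of $X\in\mathbb R^m$. The polynomial associated with a rotation-invariant probability measure $\mu$ on $\mathbb R^m$ (with exponential moments), an inverse temperature $\beta>0$ and the parameter $\gamma$ is defined as follows. Let $$\Phi(\lambda)=\frac{\int_{\mathbb R^m}\eta\,e^{\beta\langle\lambda,\eta\rangle}\mu(d\eta)}{\int_{\mathbb R^m}e^{\beta\langle\lambda,\eta\rangle}\mu(d\eta)},\qquad\lambda\in\mathbb R^m .$$ By rotation invariance there are unique $a_1,a_3,\dots,a_{2n-1}\in\mathbb R$ with $$\Phi(\lambda)-\lambda=\lambda\big(a_1+a_3|\lambda|^2+\dots+a_{2n-1}|\lambda|^{2n-2}+O(|\lambda|^{2n})\big),\quad\lambda\to0.$$ Set $\tilde{\mathfrak a}_{2k-1}=\gamma^{-(2n-2k)}a_{2k-1}$ for $k=1,\dots,n$. Then $$\tilde{\mathfrak p}_\gamma^{(j)}(X)=X^{(j)}\big(\tilde{\mathfrak a}_1+\tilde{\mathfrak a}_3|X|^2+\dots+\tilde{\mathfrak a}_{2n-1}|X|^{2n-2}\big).$$ *)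

(* Defs.v *)
From HB Require Import structures.
From mathcomp Require Import all_boot all_order all_algebra.
From mathcomp Require Import all_classical all_reals all_analysis.
(* The notations of mpoly clash with those of analysis. *)
From mathcomp Require Import -(notations) mpoly.
Import Order.TTheory GRing.Theory Num.Theory.
Import numFieldNormedType.Exports.

Set Implicit Arguments.
Unset Strict Implicit.
Unset Printing Implicit Defensive.

Local Open Scope classical_set_scope.
Local Open Scope ring_scope.

Definition borel_rV (R : realType) (m : nat) :=
  g_sigma_algebraType (@open 'rV[R]_m).

Definition dotp (R : realType) (m : nat) (x y : 'rV[R]_m) : R :=
  \sum_(i < m) x ord0 i * y ord0 i.

(* The library norm on 'rV[R]_m is the sup norm, whence this definition. *)
Definition enorm (R : realType) (m : nat) (x : 'rV[R]_m) : R :=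
  Num.sqrt (dotp x x).

Section Measures.
Variables (R : realType) (m : nat).
Implicit Types (mu : probability (borel_rV R m) R).

(* Invariance under the full orthogonal group O(m); for m >= 2 this is the same
   as invariance under SO(m), and for m = 1 it is symmetry under x |-> - x. *)
Definition rotation_invariant mu : Prop :=
  forall (Q : 'M[R]_m) (A : set (borel_rV R m)),
    Q *m Q^T = 1%:M -> measurable A ->
    mu ((fun x : 'rV[R]_m => x *m Q) @^-1` A) = mu A.

Definition exponential_moments mu : Prop :=
  forall theta : R, 0 < theta ->
    (\int[mu]_eta (expR (theta * enorm eta))%:E < +oo)%E.

Definition weakly_converges (I : Type) (F : set_system I)
    (mu : I -> probability (borel_rV R m) R)
    (nu : probability (borel_rV R m) R) : Prop :=
  forall f : 'rV[R]_m -> R, continuous f ->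
    (exists M : R, forall x, `|f x| <= M) ->
    (fun i => \int[mu i]_x f x) @ F --> \int[nu]_x f x.

Definition Phi mu (beta : R) (lambda : 'rV[R]_m) : 'rV[R]_m :=
  \row_(j < m)
    ((\int[mu]_eta ((eta : 'rV[R]_m) ord0 j * expR (beta * dotp lambda eta))) /
     (\int[mu]_eta (expR (beta * dotp lambda eta)))).

(* Coefficients are indexed by their odd subscripts: only the values a 1, a 3,
   ..., a (2 * n - 1) are relevant. *)
Definition Phi_expansion mu (beta : R) (n : nat) (a : nat -> R) : Prop :=
  exists2 r : 'rV[R]_m -> R,
    r =O_ (0 : 'rV[R]_m) (fun lambda => enorm lambda ^+ (2 * n)%N) &
    \forall lambda \near (0 : 'rV[R]_m),
      Phi mu beta lambda - lambda =
      (\sum_(1 <= k < n.+1) a (2 * k - 1)%N * enorm lambda ^+ (2 * k - 2)%N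
       + r lambda) *: lambda.

End Measures.

Section Polynomials.
Variables (R : realType) (m : nat).
Local Notation pol := (mpoly m R).

Definition varX (j : 'I_m) : pol := mpolyX R (mnm1 j).

Definition sqnormX : pol := \sum_(i < m) varX i ^+ 2.

Definition laplacian (q : pol) : pol :=
  \sum_(i < m) mderiv i (mderiv i q).

(* The series terminates: the l-th iterated Laplacian of q vanishes as soon as
   l >= msize q = 1 + deg q. *)
Definition H (q : pol) (c : R) : pol :=
  \sum_(0 <= l < msize q)
    ((- (c / 2)) ^+ l / (l`!)%:R) *: iter l laplacian q.

(* p is the j-th associated polynomial of mu; the coefficients a are determined
   by Phi_expansion, so p is unique. *)
Definition associated_poly (mu : probability (borel_rV R m) R) (beta gamma : R)
    (n : nat) (j : 'I_m) (p : pol) : Prop :=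
  exists2 a : nat -> R, Phi_expansion mu beta n a &
    p = varX j *
        \sum_(1 <= k < n.+1)
          (gamma ^- (2 * n - 2 * k)%N * a (2 * k - 1)%N)
            *: sqnormX ^+ (k - 1)%N.

End Polynomials.

Definition diverges_log (R : realType) (C : R -> R) : Prop :=
  exists c c' : R, [/\ 0 < c, c <= c' &
    \forall g \near 0^'+, c * ln (g^-1) <= C g <= c' * ln (g^-1)].

(* Main.v *)
Require Import Defs.
From HB Require Import structures.
From mathcomp Require Import all_boot all_order all_algebra.
From mathcomp Require Import -(notations) mpoly.
From mathcomp Require Import all_classical all_reals all_analysis.
From mathcomp Require Import measurable_realfun complex zify ring lra.
Import Order.TTheory GRing.Theory Num.Theory.
Import numFieldNormedType.Exports.
Local Open Scope classical_set_scope.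
Local Open Scope ring_scope.

Set Implicit Arguments.
Unset Strict Implicit.
Unset Printing Implicit Defensive.

(** The laws constructed here are mixtures of the uniform laws on finitely many
    spheres centred at the origin.  The radii do not depend on gamma; only the
    weights do, and they converge, which settles the weak convergence, the
    common compact support and the exponential moments at once.

    What remains is a truncated moment problem.  For a rotation-invariant law
    of compact support, G(l), the integral of exp(beta <l,x>), depends only on
    u = |l|^2, with Taylor coefficients
    G_k = beta^(2k) S_k / (2k)!, where S_k is the moment of order 2k of one
    coordinate, and the numerator of Phi is (2 / beta) G'(u) l.  Hence Phi has
    the coefficients a_1, a_3, ... exactly when
    (2 / beta) G' = (1 + a_1 + a_3 u + ...) G up to order n - 1 in u
    (Phi_expansion_of_moments).  This recursion determines G_1, ..., G_n from
    the prescribed a's, hence the radial moments of order 2, 4, ..., 2n to be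
    realised, and conversely these moments are all that is asked for.

    The Laplacian maps X_j |X|^(2p) to a multiple of X_j |X|^(2p-2), so the
    prescribed polynomial is X_j times a polynomial in |X|^2 whose coefficients
    are polynomials in C_gamma (wick_combination).  Undoing the scaling, the
    coefficient a_(2k-1) carries the factor gamma^(2n-2k), which beats every
    power of the logarithm (cvg_wick_coef): as gamma tends to 0, all the a's
    tend to 0 except the last one, which is constant.  So the moments to be
    realised converge to those of the centred Gaussian law of covariance 1 / b,
    up to an error on the last one that is proportional to the leading
    coefficient.

    The radial moments of a Gaussian law are interior to the set of moment
    vectors of positive measures.  Concretely, the spectral theorem for a
    Jacobi matrix yields nodes and weights with these moments
    (quadrature_exists), and the Gram matrix of the powers of the nodes is
    invertible, so that any change of the moments is obtained by multiplying
    the weights by factors 1 + O(change) (dual_quadrature_exists).  These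
    factors are positive for small changes, which is where the smallness of the
    leading coefficient enters.

    The uniform law on the sphere is obtained from Lebesgue measure on R^m,
    defined by iterated products.  A translation-invariant measure is determined
    by its value on a single symmetric set (translation_invariant_exchange);
    since a ball has the same measure as its images by orthogonal maps, Lebesgue
    measure is invariant under them. *)

(** * Borel measurability in R^m *)

Lemma borel_rV_open (R : realType) (m : nat) (U : set 'rV[R]_m) :
  open U -> measurable (U : set (borel_rV R m)).
Proof. exact: sub_sigma_algebra. Qed.

Lemma continuous_borel_rV (R : realType) (m : nat) (f : 'rV[R]_m -> R) :
  continuous f -> measurable_fun [set: borel_rV R m] f.
Proof.
move=> /continuousP cf.
apply: (measurability _ (RGenOpens.measurableE R)).
move=> _ [_ [a [b ->]] <-]; rewrite setTI.
by apply: borel_rV_open; apply: cf; exact: interval_open.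
Qed.

Lemma measurable_coord (R : realType) (m : nat) (j : 'I_m) :
  measurable_fun [set: borel_rV R m] (fun x : 'rV[R]_m => x ord0 j).
Proof. by apply: continuous_borel_rV => x; exact: coord_continuous. Qed.

(** Cubes with rational centres and inverse-integer half-sides form a countable
    base of the topology, so that open sets are countable unions of products. *)
Lemma measurable_fun_rV d (T : measurableType d) (R : realType) (m : nat)
    (f : T -> 'rV[R]_m) :
  (forall j, measurable_fun setT (fun t => f t ord0 j)) ->
  measurable_fun setT (f : T -> borel_rV R m).
Proof.
move=> mf.
apply: (@measurability _ _ T (borel_rV R m) setT f (@open 'rV[R]_m)) => [//|].
move=> _ [U oU <-]; rewrite setTI.
pose cube (p : 'rV[rat]_m * nat) : set 'rV[R]_m :=
  [set x | forall j, `|x ord0 j - ratr (p.1 ord0 j)| < p.2.+1%:R^-1].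
pose F (p : 'rV[rat]_m * nat) := if `[< cube p `<=` U >] then cube p else set0.
have -> : U = \bigcup_p F p.
  apply/seteqP; split=> [x Ux|x [p _]]; last first.
    by rewrite /F; case: asboolP => // pU; exact: pU.
  have [e /= e0 eU] : nbhs_ball x U by apply/nbhs_ballP; exact: open_nbhs_nbhs.
  have [k k0 ke] : exists2 k : nat, (0 < k)%N & 2 / k%:R < e.
    exists (Num.truncn (2 / e)).+1 => //.
    rewrite ltr_pdivrMr ?ltr0n// mulrC -ltr_pdivrMr//.
    exact: truncnS_gt.
  have kk : (0 : R) < k%:R^-1 by rewrite invr_gt0 ltr0n.
  have /choice[q qP] j : exists q : rat, `|x ord0 j - ratr q| < k%:R^-1.
    have : x ord0 j - k%:R^-1 < x ord0 j + k%:R^-1 by lra.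
    by move=> /rat_in_itvoo[q]; rewrite in_itv/= => /andP[q1 q2]; exists q;
      rewrite ltr_norml; apply/andP; split; lra.
  exists (\row_j q j, k.-1) => //; rewrite /F.
  have xc : cube (\row_j q j, k.-1) x.
    by move=> j /=; rewrite mxE prednK.
  case: asboolP => // -[] y /= yc.
  apply: eU; split => // i j; rewrite ord1.
  have := xc j; have := yc j; rewrite !mxE prednK// /ball/=.
  rewrite !ltr_norml => /andP[? ?] /andP[? ?]; apply/andP; split; lra.
rewrite preimage_bigcup; apply: countable_bigcupT_measurable => [|p].
  exact: countableP.
rewrite /F; case: ifP => _; last by rewrite preimage_set0.
rewrite (_ : _ @^-1` _ = \bigcap_(j in [set: 'I_m])
  ((fun t => f t ord0 j) @^-1` ball (ratr (p.1 ord0 j) : R) p.2.+1%:R^-1)).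
  apply: fin_bigcap_measurable => // j _; rewrite -[X in measurable X]setTI.
  by apply: mf => //; exact: measurable_ball.
rewrite /cube /ball/=; apply/seteqP; split=> t /=.
  by move=> H j _; rewrite /= distrC; exact: H.
by move=> H j; rewrite distrC; exact: H.
Qed.

(** * Translation-invariant measures on R^m *)

Section uniqueness.
Context (R : realType) (m : nat).
Implicit Types mu nu : {measure set (borel_rV R m) -> \bar R}.

Definition translation_invariant (mu : set (borel_rV R m) -> \bar R) :=
  forall (v : 'rV[R]_m) (A : set (borel_rV R m)), measurable A ->
    mu ((fun x : 'rV[R]_m => x + v) @^-1` A) = mu A.

Lemma measurable_addr : measurable_fun
  [set: borel_rV R m * borel_rV R m]
  ((fun p => (p.1 : 'rV[R]_m) + p.2) :
   borel_rV R m * borel_rV R m -> borel_rV R m).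
Proof.
apply: measurable_fun_rV => j.
rewrite (_ : (fun _ => _) = (fun p : borel_rV R m * borel_rV R m =>
   (p.1 : 'rV[R]_m) ord0 j + (p.2 : 'rV[R]_m) ord0 j)); last first.
  by apply/funext => p; rewrite mxE.
apply: measurable_funD.
- exact: (measurableT_comp (measurable_coord j)).
- exact: (measurableT_comp (measurable_coord j)).
Qed.

Lemma measurable_subr : measurable_fun
  [set: borel_rV R m * borel_rV R m]
  ((fun p => (p.2 : 'rV[R]_m) - p.1) :
   borel_rV R m * borel_rV R m -> borel_rV R m).
Proof.
apply: measurable_fun_rV => j.
rewrite (_ : (fun _ => _) = (fun p : borel_rV R m * borel_rV R m =>
   (p.2 : 'rV[R]_m) ord0 j - (p.1 : 'rV[R]_m) ord0 j)); last first.
  by apply/funext => p; rewrite !mxE.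
apply: measurable_funB.
- exact: (measurableT_comp (measurable_coord j)).
- exact: (measurableT_comp (measurable_coord j)).
Qed.

(** Both sides are values of one double integral: mu A * nu D integrates the
    indicator of (y in D and x + y in A); the substitution of y by y - x, allowed
    by the invariance of nu, turns it into (y in A and y - x in D), which
    integrates to nu A * mu (- D). *)
Lemma translation_invariant_exchange
    (mu nu : {sigma_finite_measure set (borel_rV R m) -> \bar R})
    (A D : set (borel_rV R m)) :
  translation_invariant mu -> translation_invariant nu ->
  measurable A -> measurable D -> (forall x : 'rV[R]_m, D x -> D (- x)) ->
  (mu A * nu D = mu D * nu A)%E.
Proof.
move=> tmu tnu mA mD symD.
pose S := [set p : borel_rV R m * borel_rV R m |
  D p.2 /\ A ((p.1 : 'rV[R]_m) + p.2)].
pose S' := [set p : borel_rV R m * borel_rV R m |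
  A p.2 /\ D ((p.2 : 'rV[R]_m) - p.1)].
have mS : measurable S.
  rewrite (_ : S = (setT `&` snd @^-1` D) `&` (setT `&`
    (fun p : borel_rV R m * borel_rV R m => (p.1 : 'rV[R]_m) + p.2) @^-1` A)).
    by apply: measurableI; [exact: measurable_snd|exact: measurable_addr].
  by apply/seteqP; split => p; rewrite !setTI.
have mS' : measurable S'.
  rewrite (_ : S' = (setT `&` snd @^-1` A) `&` (setT `&`
    (fun p : borel_rV R m * borel_rV R m => (p.2 : 'rV[R]_m) - p.1) @^-1` D)).
    by apply: measurableI; [exact: measurable_snd|exact: measurable_subr].
  by apply/seteqP; split => p; rewrite !setTI.
(* The substitution of y by y - x, section by section. *)
have E1 : (\int[mu]_x nu (xsection S x) = \int[mu]_x nu (xsection S' x))%E.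
  apply: eq_integral => x _.
  rewrite -(tnu x (xsection S' x)); last exact: measurable_xsection.
  congr (nu _); apply/seteqP; split => y /=.
    by move=> /xsectionP[/= Dy Ay]; apply/xsectionP; split => /=;
      rewrite ?addrK// addrC.
  by move=> /xsectionP[/= Dy]; rewrite addrK => Ay; apply/xsectionP;
    split => //=; rewrite addrC.
have := @indic_fubini_tonelli _ _ _ _ _ mu nu _ mS'.
have := @indic_fubini_tonelli _ _ _ _ _ mu nu _ mS.
rewrite !indic_fubini_tonelli_FE// !indic_fubini_tonelli_GE//= E1 => -> h.
transitivity (\int[nu]_y (mu \o ysection S) y)%E.
  rewrite -integral_cst// integral_mkcond; apply: eq_integral => y _ /=.
  rewrite patchE; case: ifPn => [/set_mem Dy|/negP Dy].
    rewrite /= -(tmu y A mA); congr (mu _); apply/seteqP; split => x /=.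
      by move=> ?; apply/ysectionP.
    by move=> /ysectionP[].
  rewrite (_ : ysection _ _ = set0) ?measure0//.
  by apply/seteqP; split => // x /ysectionP[/= /mem_set].
rewrite /= h -integral_cst// integral_mkcond; apply: eq_integral => y _ /=.
rewrite patchE; case: ifPn => [/set_mem Dy|/negP Dy].
  rewrite /= -(tmu (- y) D mD); congr (mu _); apply/seteqP; split => x /=.
    by move=> /ysectionP[/= _ /symD]; rewrite opprB.
  by move=> /symD; rewrite opprB => ?; apply/ysectionP.
rewrite (_ : ysection _ _ = set0) ?measure0//.
by apply/seteqP; split => // x /ysectionP[/= /mem_set].
Qed.

End uniqueness.

Lemma lebesgue_translation (R : realType) (a : R) (A : set R) :
  measurable A ->
  lebesgue_measure ((fun x : R => x + a) @^-1` A) = lebesgue_measure A.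
Proof.
have ma : measurable_fun [set: measurableTypeR R]
    ((fun x : R => x + a) : measurableTypeR R -> measurableTypeR R).
  exact: (measurable_funD (@measurable_id _ (measurableTypeR R) _) (measurable_cst _)).
move=> mA; apply/esym.
apply: (@lebesgue_measure_unique R (pushforward (@lebesgue_measure R)
  ((fun x : R => x + a) : measurableTypeR R -> measurableTypeR R))) => // _ [[b c]] _ <-.
rewrite /pushforward.
rewrite [X in _ = lebesgue_measure X](_ : _ = `](b - a), (c - a)]%classic); last first.
  by apply/seteqP; split => x /=; rewrite !in_itv/= ltrBlDr lerBrDr.
rewrite !lebesgue_measure_itv/= !lte_fin ltrD2r.
by case: ifP => // _; rewrite -!EFinB; congr (_%:E); ring.
Qed.

(** Being sigma-finite is part of the type of the measures to which Fubini's
    theorem applies; this turns a proof of it into such a measure. *)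
Section sigma_finite_repack.
Context d (T : measurableType d) (R : realType).
Variables (mu : {measure set T -> \bar R}) (sf : sigma_finite setT mu).

Let nu : set T -> \bar R := mu.
HB.instance Definition _ := Measure.on nu.
HB.instance Definition _ := Measure_isSigmaFinite.Build _ _ _ nu sf.

Lemma sigma_finite_repack :
  exists nu : {sigma_finite_measure set T -> \bar R},
    (nu : set T -> \bar R) = mu.
Proof. by exists nu. Qed.

End sigma_finite_repack.

Definition box (R : realType) (m : nat) (N : nat) : set (borel_rV R m) :=
  [set x | forall j, `|(x : 'rV[R]_m) ord0 j| <= N%:R].

Definition unit_cube (R : realType) (m : nat) : set (borel_rV R m) :=
  [set x | forall j, 0 < (x : 'rV[R]_m) ord0 j <= 1].

Arguments box : clear implicits.
Arguments unit_cube : clear implicits.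

Lemma measurable_coords (R : realType) (m : nat) (B : set R) :
  measurable B ->
  measurable ([set x | forall j, B ((x : 'rV[R]_m) ord0 j)] : set (borel_rV R m)).
Proof.
move=> mB.
rewrite (_ : [set _ | _] = \bigcap_(j in [set: 'I_m])
  ((fun x : borel_rV R m => (x : 'rV[R]_m) ord0 j) @^-1` B)).
  apply: fin_bigcap_measurable => // j _; rewrite -[X in measurable X]setTI.
  exact: measurable_coord.
by apply/seteqP; split => x /= H j; [move=> _; exact: H|exact: (H j I)].
Qed.

Lemma measurable_box (R : realType) (m N : nat) : measurable (box R m N).
Proof.
rewrite (_ : box R m N =
  [set x | forall j, `[- N%:R, N%:R]%classic ((x : 'rV[R]_m) ord0 j)]).
  exact: measurable_coords.
by apply/seteqP; split => x /= H j; move: (H j); rewrite /= in_itv/= ler_norml.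
Qed.

Lemma measurable_unit_cube (R : realType) (m : nat) : measurable (unit_cube R m).
Proof.
rewrite (_ : unit_cube R m = [set x | forall j, `]0, 1]%classic ((x : 'rV[R]_m) ord0 j)]).
  exact: measurable_coords.
by apply/seteqP; split => x /= H j; move: (H j); rewrite /= in_itv/=.
Qed.

Lemma bigcup_box (R : realType) (m : nat) :
  [set: borel_rV R m] = \bigcup_N box R m N.
Proof.
apply/seteqP; split => // x _.
exists (Num.truncn `|x : 'rV[R]_m|).+1 => // j /=.
apply: ltW; apply: le_lt_trans (truncnS_gt _).
have := mx_normrE (x : 'rV[R]_m); rewrite /Num.norm/= => ->.
by apply: le_trans (le_bigmax _ _ (ord0, j)).
Qed.

(** The image measure, carrying the proof of measurability that makes it a
    measure. *)
Definition push_measure d1 d2 (X : measurableType d1) (Y : measurableType d2)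
    (R : realType) (phi : X -> Y) (mphi : measurable_fun setT phi)
    (mu : {measure set X -> \bar R}) : {measure set Y -> \bar R} :=
  ltac:(refine (pushforward mu phi : {measure set Y -> \bar R}); exact: mphi).

Section lebesgue_step.
Context (R : realType) (m : nat).
Variable mu : {sigma_finite_measure set (borel_rV R m) -> \bar R}.

Definition consrV (p : measurableTypeR R * borel_rV R m) : borel_rV R m.+1 :=
  \row_j (if unlift ord0 j is Some i then (p.2 : 'rV[R]_m) ord0 i else p.1).

Lemma measurable_consrV : measurable_fun setT consrV.
Proof.
apply: measurable_fun_rV => j.
rewrite (_ : (fun _ => _) = (fun p => if unlift ord0 j is Some i
  then (p.2 : 'rV[R]_m) ord0 i else p.1 : R)); last first.
  by apply/funext => p; rewrite mxE.
case: unliftP => [i _|_]; last exact: measurable_fst.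
exact: (measurableT_comp (measurable_coord i)).
Qed.

Local Notation P := ((@lebesgue_measure R) \x mu)%E.

Lemma product_translation (a : R) (v : 'rV[R]_m)
    (S : set (measurableTypeR R * borel_rV R m)) :
  translation_invariant mu -> measurable S ->
  P ((fun p => ((p.1 : R) + a, (p.2 : 'rV[R]_m) + v)) @^-1` S) = P S.
Proof.
move=> tmu mS.
pose sh : measurableTypeR R * borel_rV R m -> measurableTypeR R * borel_rV R m :=
  fun p => ((p.1 : R) + a, (p.2 : 'rV[R]_m) + v).
have msh : measurable_fun setT sh.
  apply: measurable_fun_pair.
    apply: (measurable_funD _ (measurable_cst _)).
    exact: (measurable_fst : measurable_fun setT (fun p => p.1 : R)).
  apply: measurable_fun_rV => j.
  rewrite (_ : (fun _ => _) = (fun p : measurableTypeR R * borel_rV R m =>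
     (p.2 : 'rV[R]_m) ord0 j + v ord0 j)).
    apply: measurable_funD => //.
    exact: (measurableT_comp (measurable_coord j)).
  by apply/funext => p; rewrite mxE.
apply/esym.
apply: (@product_measure_unique _ _ _ _ _ _ _
  (pushforward P sh : {measure set _ -> \bar R})) => // A B mA mB.
transitivity (P (((fun x : R => x + a) @^-1` A) `*`
   ((fun x : 'rV[R]_m => x + v) @^-1` B))); first by [].
rewrite product_measure1E//=.
- by rewrite tmu// lebesgue_translation.
- rewrite -[X in measurable X]setTI.
  exact: (measurable_funD (@measurable_id _ (measurableTypeR R) _) (measurable_cst _)).
- rewrite -[X in measurable X]setTI.
  have mv : measurable_fun [set: borel_rV R m] ((fun x : 'rV[R]_m => x + v) :
      borel_rV R m -> borel_rV R m).
    apply: measurable_fun_rV => j.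
    rewrite (_ : (fun _ => _) = (fun p : borel_rV R m =>
       (p : 'rV[R]_m) ord0 j + v ord0 j)).
      by apply: measurable_funD => //; exact: measurable_coord.
    by apply/funext => p; rewrite mxE.
  exact: mv.
Qed.

Lemma lebesgue_rV_step :
  translation_invariant mu -> (0 < mu (unit_cube R m))%E ->
  (forall N, mu (box R m N) < +oo)%E ->
  exists nu : {sigma_finite_measure set (borel_rV R m.+1) -> \bar R},
  [/\ translation_invariant nu, (0 < nu (unit_cube R m.+1))%E &
   forall N, (nu (box R m.+1 N) < +oo)%E].
Proof.
move=> tmu c_gt0 b_fin.
have /= mph := measurable_consrV.
pose nu : {measure set (borel_rV R m.+1) -> \bar R} := push_measure mph P.
have consE (B : set R) :
    consrV @^-1` [set x | forall j, B ((x : 'rV[R]_m.+1) ord0 j)] =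
    B `*` [set x | forall j, B ((x : 'rV[R]_m) ord0 j)].
  apply/seteqP; split => [[x y] /= H|[x y] [/= Bx By] j].
    split => [|j]; first by have := H ord0; rewrite mxE unlift_none.
    by have := H (lift ord0 j); rewrite mxE liftK.
  by rewrite /= mxE; case: unliftP.
have nub N : (nu (box R m.+1 N) < +oo)%E.
  rewrite /nu/= /push_measure/= /pushforward (consE [set x | `|x| <= N%:R]).
  rewrite product_measure1E//=; last exact: measurable_box.
    rewrite lte_mul_pinfty//.
    - rewrite (_ : [set _ | _] = `[- N%:R, N%:R]%classic) ?lebesgue_measure_itv//=.
        by rewrite lte_fin; case: ifP.
      by apply/seteqP; split => x /=; rewrite in_itv/= ler_norml.
    - exact: b_fin.
  rewrite (_ : [set _ | _] = `[- N%:R, N%:R]%classic)//.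
  by apply/seteqP; split => x /=; rewrite in_itv/= ler_norml.
have sf : sigma_finite setT nu.
  exists (fun N => box R m.+1 N); first exact: bigcup_box.
  by move=> N; split => //; exact: measurable_box.
have [nu' nu'E] := sigma_finite_repack sf.
exists nu'; rewrite nu'E; split => //.
  move=> v A mA; rewrite /nu/= /push_measure/= /pushforward.
  rewrite -[RHS](@product_translation (v ord0 ord0) (\row_j v ord0 (lift ord0 j)))//.
  2:{ by rewrite -[X in measurable X]setTI; exact: measurable_consrV. }
  congr (_ _); apply/funext => -[x y] /=; congr (A _).
  by apply/rowP => j; rewrite !mxE; case: unliftP => [i ->|->//]; rewrite !mxE.
have cE : [set x : R | 0 < x <= 1] = `]0, 1]%classic.
  by apply/seteqP; split => x /=; rewrite in_itv/=.
rewrite /nu/= /push_measure/= /pushforward (consE [set x | 0 < x <= 1]).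
rewrite product_measure1E//=; last exact: measurable_unit_cube.
  rewrite mule_gt0//; have -> := cE.
  by rewrite lebesgue_measure_itv//= lte_fin ltr01 sube0.
by rewrite cE.
Qed.

End lebesgue_step.

(** Lebesgue measure on R^m, characterised by translation invariance up to a
    factor; the other two properties make it non-trivial and locally finite. *)
Lemma lebesgue_rV_exists (R : realType) (m : nat) :
  exists nu : {sigma_finite_measure set (borel_rV R m) -> \bar R},
  [/\ translation_invariant nu, (0 < nu (unit_cube R m))%E &
   forall N, (nu (box R m N) < +oo)%E].
Proof.
elim: m => [|m [nu [? ? ?]]]; last exact: (lebesgue_rV_step (mu := nu)).
exists (@dirac _ (borel_rV R 0) (0 : 'rV[R]_0) R); split => [v A mA| |N].
- congr (dirac _ _); apply/funext => x; rewrite /preimage/=.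
  by congr (A _); apply/rowP; case.
- by rewrite /= /dirac indicE mem_set ?lte_fin//; case.
- by rewrite /= /dirac indicE ltry.
Qed.

(** * The uniform law on the unit sphere *)

Lemma cvg_sumr (R : realType) (T I : Type) (F : set_system T) {FF : Filter F}
    (r : seq I) (P : pred I) (f : I -> T -> R) (l : I -> R) :
  (forall i, P i -> f i x @[x --> F] --> l i) ->
  \sum_(i <- r | P i) f i x @[x --> F] --> \sum_(i <- r | P i) l i.
Proof. by move=> fl; apply: cvg_big => //; exact: add_continuous. Qed.

Section dotp_theory.
Context (R : realType) (m : nat).
Implicit Types x y z : 'rV[R]_m.

Lemma dotpE x y : dotp x y = (x *m y^T) ord0 ord0.
Proof. by rewrite mxE; apply: eq_bigr => i _; rewrite mxE. Qed.

Lemma dotpC x y : dotp x y = dotp y x.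
Proof. by apply: eq_bigr => i _; rewrite mulrC. Qed.

Lemma dotpDl x y z : dotp (x + y) z = dotp x z + dotp y z.
Proof. by rewrite -big_split; apply: eq_bigr => i _; rewrite mxE mulrDl. Qed.

Lemma dotpZl (a : R) x y : dotp (a *: x) y = a * dotp x y.
Proof. by rewrite mulr_sumr; apply: eq_bigr => i _; rewrite mxE mulrA. Qed.

Lemma dotpNl x y : dotp (- x) y = - dotp x y.
Proof. by rewrite -scaleN1r dotpZl mulN1r. Qed.

Lemma dotpDr x y z : dotp x (y + z) = dotp x y + dotp x z.
Proof. by rewrite dotpC dotpDl !(dotpC x). Qed.

Lemma dotpZr (a : R) x y : dotp x (a *: y) = a * dotp x y.
Proof. by rewrite dotpC dotpZl dotpC. Qed.

Lemma dotpNr x y : dotp x (- y) = - dotp x y.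
Proof. by rewrite dotpC dotpNl dotpC. Qed.

Lemma dotp_ge0 x : 0 <= dotp x x.
Proof. by apply: sumr_ge0 => i _; exact: sqr_ge0. Qed.

Lemma dotp_eq0 x : (dotp x x == 0) = (x == 0).
Proof.
apply/eqP/eqP => [|->]; last by rewrite -(scale0r 0) dotpZl mul0r.
move=> x0; apply/rowP => i; rewrite mxE; apply/eqP.
have /psumr_eq0P : \sum_(i < m) x ord0 i * x ord0 i = 0 by exact: x0.
move=> /(_ (fun i _ => sqr_ge0 (x ord0 i)) i isT)/eqP.
by rewrite mulf_eq0 orbb.
Qed.

Lemma dotp_gt0 x : (0 < dotp x x) = (x != 0).
Proof. by rewrite lt_neqAle dotp_ge0 andbT eq_sym dotp_eq0. Qed.

Lemma enorm_ge0 x : 0 <= enorm x. Proof. exact: sqrtr_ge0. Qed.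

Lemma enorm_sqr x : enorm x ^+ 2 = dotp x x.
Proof. by rewrite sqr_sqrtr ?dotp_ge0. Qed.

Lemma dotp_mulmx (Q : 'M[R]_m) x y :
  Q *m Q^T = 1%:M -> dotp (x *m Q) (y *m Q) = dotp x y.
Proof. by move=> QQ; rewrite !dotpE trmx_mul mulmxA -(mulmxA x) QQ mulmx1. Qed.

Lemma dotp_delta (j : 'I_m) x : dotp (delta_mx ord0 j) x = x ord0 j.
Proof.
rewrite /dotp (bigD1 j)//= mxE !eqxx mul1r big1 ?addr0// => i ij.
by rewrite mxE (negbTE ij) andbF mul0r.
Qed.

Lemma coord_sqr_le x j : (x ord0 j) ^+ 2 <= dotp x x.
Proof.
rewrite /dotp (bigD1 j)//= -expr2 lerDl; apply: sumr_ge0 => i _.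
exact: sqr_ge0.
Qed.

Lemma continuous_dotp x : continuous (dotp x).
Proof.
move=> y; rewrite /dotp.
apply: (@cvg_sumr _ _ _ (nbhs y)) => // i _; apply: cvgMr; exact: coord_continuous.
Qed.

Lemma continuous_sqnorm : continuous (fun x => dotp x x).
Proof.
move=> y; rewrite /dotp.
by apply: (@cvg_sumr _ _ _ (nbhs y)) => // i _; apply: cvgM; exact: coord_continuous.
Qed.

Lemma continuous_enorm : continuous (@enorm R m).
Proof.
move=> x; apply: (@continuous_comp _ _ _ (fun x => dotp x x) Num.sqrt).
  exact: continuous_sqnorm.
exact: sqrt_continuous.
Qed.

Lemma measurable_mulmx (Q : 'M[R]_m) : measurable_fun [set: borel_rV R m]
  ((fun x : 'rV[R]_m => x *m Q) : borel_rV R m -> borel_rV R m).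
Proof.
apply: measurable_fun_rV => j.
apply: (continuous_borel_rV (f := fun x : 'rV[R]_m => (x *m Q) ord0 j)).
rewrite (_ : (fun _ => _) = (fun x => dotp (\row_i Q i j) x)).
  exact: continuous_dotp.
by apply/funext => x; rewrite mxE; apply: eq_bigr => i _; rewrite mxE mulrC.
Qed.

End dotp_theory.

Section sphere.
Context (R : realType) (m : nat).

(** The radius is such that the ball contains the unit cube, hence has positive
    measure; the origin, which has no radial projection, is left out. *)
Definition punctured_ball : set (borel_rV R m) :=
  [set x | 0 < dotp (x : 'rV[R]_m) x <= m%:R].

Lemma measurable_punctured_ball : measurable punctured_ball.
Proof.
have := continuous_borel_rV (@continuous_sqnorm R m).
move=> /(_ measurableT _ (measurable_itv `]0, m%:R])).
by rewrite setTI.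
Qed.

Lemma punctured_ball_mulmx (Q : 'M[R]_m) : Q *m Q^T = 1%:M ->
  (fun x : 'rV[R]_m => x *m Q) @^-1` punctured_ball = punctured_ball.
Proof. by move=> QQ; apply/funext => x; rewrite /punctured_ball/preimage/= dotp_mulmx. Qed.

Lemma unit_cube_punctured_ball : (0 < m)%N -> unit_cube R m `<=` punctured_ball.
Proof.
move=> m0 x /= ux; apply/andP; split.
  rewrite dotp_gt0; apply/eqP => x0.
  by have := ux (Ordinal m0); rewrite x0 mxE ltxx.
rewrite /dotp; apply: le_trans (_ : \sum_(i < m) 1 <= _).
  apply: ler_sum => i _; have /andP[x0 x1] := ux i.
  by rewrite -expr2 expr_le1// ltW.
by rewrite sumr_const card_ord.
Qed.

Lemma punctured_ball_box : punctured_ball `<=` box R m m.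
Proof.
move=> x /= /andP[_ xm] j; have := coord_sqr_le x j.
move=> /le_trans /(_ xm) h; rewrite -(ler_pXn2r (n := 2))// ?nnegrE//.
rewrite real_normK ?num_real//; apply: (le_trans h).
by rewrite -natrX ler_nat -mulnn; case: (m) => // k; rewrite leq_pmull.
Qed.

(** The image of nu by Q is again translation-invariant, hence proportional to
    nu; the factor is 1 because both agree on a ball. *)
Lemma orthogonal_invariance_of_translation_invariance (nu : {sigma_finite_measure set (borel_rV R m) -> \bar R})
    (Q : 'M[R]_m) (A : set (borel_rV R m)) :
  translation_invariant nu -> (0 < nu punctured_ball < +oo)%E ->
  (forall N, (nu (box R m N) < +oo)%E) ->
  Q *m Q^T = 1%:M -> measurable A ->
  nu ((fun x : 'rV[R]_m => x *m Q) @^-1` A) = nu A.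
Proof.
move=> tnu /andP[D_gt0 D_fin] nu_box QQ mA.
have QQ' : Q^T *m Q = 1%:M by exact: mulmx1C.
pose nuQ := push_measure (measurable_mulmx Q) nu.
have sf : sigma_finite setT nuQ.
  exists (fun N => (fun x : 'rV[R]_m => x *m Q^T) @^-1` box R m N).
    by rewrite -preimage_bigcup -bigcup_box preimage_setT.
  move=> N; split.
    rewrite -[X in measurable X]setTI.
    by apply: measurable_mulmx => //; exact: measurable_box.
  rewrite /nuQ/push_measure/= /pushforward.
  rewrite (_ : _ @^-1` _ = box R m N)//.
  by apply/funext => x; rewrite /preimage/= -mulmxA QQ mulmx1.
have [nu' nu'E] := sigma_finite_repack sf.
have tnu' : translation_invariant nu'.
  move=> v B mB; rewrite nu'E /nuQ/push_measure/=/pushforward.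
  rewrite -[RHS](tnu (v *m Q^T)); last first.
    by rewrite -[X in measurable X]setTI; exact: measurable_mulmx.
  congr (nu _); apply/funext => x; rewrite /preimage/=; congr (B _).
  by rewrite mulmxDl -mulmxA QQ' mulmx1.
have := translation_invariant_exchange tnu' tnu mA measurable_punctured_ball.
rewrite nu'E /nuQ/push_measure/=/pushforward punctured_ball_mulmx// => /(_ _)/esym h.
have {}h : (nu ((fun x : 'rV[R]_m => x *m Q) @^-1` A) * nu punctured_ball =
    nu punctured_ball * nu A)%E.
  by rewrite h// => x; rewrite /punctured_ball/= dotpNl dotpNr opprK.
have Dfin : nu punctured_ball \is a fin_num by rewrite ge0_fin_numE// ltW.
have pmul := lee_pmul2l Dfin D_gt0.
by apply/eqP; rewrite eq_le; apply/andP; split; rewrite -pmul -h muleC.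
Qed.

End sphere.

Section sphere_measure.
Context (R : realType) (m : nat).

(** Same device as sigma_finite_repack, for probability measures. *)
Section probability_repack.
Context d (T : measurableType d).
Variables (mu : {measure set T -> \bar R}) (mu1 : mu setT = 1%E).

Let P : set T -> \bar R := mu.
HB.instance Definition _ := Measure.on P.
HB.instance Definition _ := Measure_isProbability.Build _ _ _ P mu1.

Lemma probability_repack :
  exists nu : probability T R, (nu : set T -> \bar R) = mu.
Proof. by exists P. Qed.

End probability_repack.

Definition unit_sphere : set (borel_rV R m) := [set x | dotp (x : 'rV[R]_m) x = 1].

(** The map x |-> x / |x|, written with a power of |x|^2, whose measurability is
    immediate. *)
Definition radial_proj (x : borel_rV R m) : borel_rV R m :=
  (dotp (x : 'rV[R]_m) x `^ (- 2^-1)) *: (x : 'rV[R]_m).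

Lemma measurable_radial_proj : measurable_fun setT radial_proj.
Proof.
apply: measurable_fun_rV => j.
rewrite (_ : (fun _ => _) = (fun x : borel_rV R m =>
  (dotp (x : 'rV[R]_m) x `^ (- 2^-1)) * (x : 'rV[R]_m) ord0 j)); last first.
  by apply/funext => x; rewrite mxE.
apply: measurable_funM; last exact: measurable_coord.
apply: (measurableT_comp (f := fun s : R => s `^ (- 2^-1))).
  exact: measurable_powR.
exact: (continuous_borel_rV (@continuous_sqnorm R m)).
Qed.

Lemma radial_proj_unit_sphere x : (x : 'rV[R]_m) != 0 -> unit_sphere (radial_proj x).
Proof.
rewrite -dotp_gt0 => x0.
rewrite /unit_sphere/radial_proj/= dotpZl dotpZr mulrA -powRD; last first.
  by rewrite (gt_eqF x0) implybT.
have -> : - 2^-1 + - 2^-1 = - 1 :> R by lra.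
by rewrite powR_inv1 ?ltW// mulVf// gt_eqF.
Qed.

(** Project radially the normalised restriction of Lebesgue measure to a ball:
    the projection commutes with orthogonal maps. *)
Lemma sphere_measure_exists : (0 < m)%N ->
  exists2 sigma : probability (borel_rV R m) R, rotation_invariant sigma &
    sigma (~` unit_sphere) = 0%E.
Proof.
move=> m_gt0.
have [nu [tnu c_gt0 box_fin]] := lebesgue_rV_exists R m.
have mD := @measurable_punctured_ball R m.
have D_gt0 : (0 < nu (@punctured_ball R m))%E.
  apply: (lt_le_trans c_gt0); apply: le_measure; rewrite ?inE//.
    exact: measurable_unit_cube.
  exact: unit_cube_punctured_ball.
have D_fin : (nu (@punctured_ball R m) < +oo)%E.
  apply: le_lt_trans (box_fin m); apply: le_measure; rewrite ?inE//.
    exact: measurable_box.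
  exact: punctured_ball_box.
have Dfin : nu (@punctured_ball R m) \is a fin_num by rewrite ge0_fin_numE// ltW.
have c_ge0 : 0 <= (fine (nu (@punctured_ball R m)))^-1 by rewrite invr_ge0 fine_ge0.
pose rho : {measure set (borel_rV R m) -> \bar R} :=
  mscale (NngNum c_ge0) (mrestr nu mD).
pose P := push_measure measurable_radial_proj rho.
have PE A : P A = ((fine (nu (@punctured_ball R m)))^-1%:E *
  nu (radial_proj @^-1` A `&` @punctured_ball R m))%E by [].
have [sigma sigmaE] : exists sigma : probability (borel_rV R m) R,
    (sigma : set _ -> \bar R) = P.
  apply: probability_repack; rewrite PE preimage_setT setTI.
  rewrite -[X in (_ * X)%E](fineK Dfin) -EFinM mulVf// gt_eqF// fine_gt0//.
  by rewrite D_gt0.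
exists sigma.
  move=> Q A QQ mA; rewrite sigmaE !PE; congr (_ * _)%E.
  rewrite -[RHS](orthogonal_invariance_of_translation_invariance tnu _ box_fin QQ); first last.
  - apply: measurableI => //; rewrite -[X in measurable X]setTI.
    exact: measurable_radial_proj.
  - by rewrite D_gt0.
  congr (nu _); apply/funext => x; rewrite /preimage/setI/=.
  have := congr1 (fun B => B x) (punctured_ball_mulmx QQ); rewrite /preimage/= => ->.
  by rewrite /radial_proj dotp_mulmx// scalemxAl.
rewrite sigmaE PE (_ : _ `&` _ = set0) ?measure0 ?mule0//.
apply/seteqP; split => // x [/= xS /andP[]]; rewrite dotp_gt0 => x0 _.
exact/xS/radial_proj_unit_sphere.
Qed.

End sphere_measure.

(** * Continuous functions and compactly supported laws *)

Section continuous_real.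
Context (R : realType) (T : topologicalType).
Implicit Types f g : T -> R.

Lemma continuousR_cst (c : R) : continuous (fun _ : T => c).
Proof. by move=> x; exact: cvg_cst. Qed.

Lemma continuousR_add f g : continuous f -> continuous g -> continuous (fun x => f x + g x).
Proof. by move=> cf cg x; exact: (cvgD (cf x) (cg x)). Qed.

Lemma continuousR_mul f g : continuous f -> continuous g -> continuous (fun x => f x * g x).
Proof. by move=> cf cg x; exact: (cvgM (cf x) (cg x)). Qed.

Lemma continuousR_scale (c : R) f : continuous f -> continuous (fun x => c * f x).
Proof. exact/continuousR_mul/continuousR_cst. Qed.

Lemma continuousR_exp f k : continuous f -> continuous (fun x => f x ^+ k).
Proof.
move=> cf; elim: k => [|k IH]; first exact: continuousR_cst.
rewrite (_ : (fun _ => _) = (fun x => f x * f x ^+ k)); first exact: continuousR_mul.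
by apply/funext => x; rewrite exprS.
Qed.

Lemma continuousR_expR f : continuous f -> continuous (fun x => expR (f x)).
Proof.
by move=> cf x; apply: (@continuous_comp _ _ _ f expR); [exact: cf|exact: continuous_expR].
Qed.

Lemma continuousR_norm f : continuous f -> continuous (fun x => `|f x|).
Proof. by move=> cf x; exact: (cvg_norm (cf x)). Qed.

Lemma continuousR_sum (I : Type) (r : seq I) (F : I -> T -> R) :
  (forall i, continuous (F i)) -> continuous (fun x => \sum_(i <- r) F i x).
Proof. by move=> cF x; apply: (@cvg_sumr _ _ _ (nbhs x)) => i _; exact: cF. Qed.

End continuous_real.

Lemma continuous_rV (R : realType) (m : nat) (T : topologicalType)
    (f : T -> 'rV[R]_m) :
  (forall j, continuous (fun t => f t ord0 j)) -> continuous f.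
Proof.
move=> cf x A [P xP PA].
suff : \forall t \near x, forall j, P ord0 j (f t ord0 j).
  by apply: filterS => t H; apply: PA => i j; rewrite ord1.
by apply: filter_forall => j; apply: cf; exact: xP.
Qed.

Section compact_support.
Context (R : realType) (m : nat).
Variables (mu : probability (borel_rV R m) R) (K : set 'rV[R]_m).
Hypotheses (cK : compact K) (muK : mu (~` K) = 0%E).
Implicit Types f g : 'rV[R]_m -> R.

Lemma measurable_compact : measurable (K : set (borel_rV R m)).
Proof.
rewrite -(setCK K); apply: measurableC; apply: borel_rV_open.
by rewrite openC; apply: compact_closed => //; exact: norm_hausdorff.
Qed.

Lemma integrable_compact f : continuous f -> mu.-integrable setT (EFin \o f).
Proof.
move=> cf; have mf := continuous_borel_rV cf; have mK := measurable_compact.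
apply/(@negligible_integrable _ _ _ mu setT (~` K)) => //.
- exact: measurableC.
- exact/measurable_EFinP.
rewrite setTD setCK; apply: measurable_bounded_integrable => //.
- exact: (le_lt_trans (probability_le1 mu mK) (ltry _)).
- exact: measurable_funS mf.
have /compact_bounded : compact (f @` K).
  by apply: continuous_compact => //; exact: continuous_subspaceT.
case=> M [Mreal HM]; exists M; split => // x Mx y Ky.
by apply: (HM x Mx); exists y.
Qed.

Lemma Rintegral_compact_eq f g : continuous f -> continuous g ->
  {in K, f =1 g} -> \int[mu]_x f x = \int[mu]_x g x.
Proof.
move=> cf cg fg; have mK := measurable_compact; congr fine.
rewrite (@negligible_integral _ _ _ mu setT (~` K))//; last 2 first.
- exact: measurableC.
- exact: integrable_compact.
rewrite [RHS](@negligible_integral _ _ _ mu setT (~` K))//; last 2 first.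
- exact: measurableC.
- exact: integrable_compact.
rewrite setTD setCK; apply: eq_integral => x xK.
by rewrite fg.
Qed.

Lemma Rintegral_compactD f g : continuous f -> continuous g ->
  \int[mu]_x (f x + g x) = \int[mu]_x f x + \int[mu]_x g x.
Proof. by move=> cf cg; rewrite RintegralD//; exact: integrable_compact. Qed.

Lemma Rintegral_compactZ (a : R) f : continuous f ->
  \int[mu]_x (a * f x) = a * \int[mu]_x f x.
Proof. by move=> cf; rewrite RintegralZl//; exact: integrable_compact. Qed.

Lemma Rintegral_compact_sum (I : Type) (r : seq I) (F : I -> 'rV[R]_m -> R) :
  (forall i, continuous (F i)) ->
  \int[mu]_x (\sum_(i <- r) F i x) = \sum_(i <- r) \int[mu]_x F i x.
Proof.
move=> cF; elim: r => [|i r IH].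
  rewrite big_nil (eq_Rintegral _ (g := fun => 0)) => [|x _].
    by rewrite Rintegral_cst// mul0r.
  by rewrite big_nil.
rewrite big_cons -IH -Rintegral_compactD//; last exact: continuousR_sum.
by apply: eq_Rintegral => x _; rewrite big_cons.
Qed.

Lemma Rintegral_compact_cst (c : R) : \int[mu]_x c = c.
Proof. by rewrite Rintegral_cst//= probability_setT mulr1. Qed.

Lemma Rintegral_compact_le f g : continuous f -> continuous g ->
  {in K, forall x, f x <= g x} -> \int[mu]_x f x <= \int[mu]_x g x.
Proof.
move=> cf cg fg.
have cNf : continuous (fun x => (- 1) * f x).
  exact: continuousR_scale.
have cfg : continuous (fun x => g x + (- 1) * f x).
  exact: continuousR_add.
rewrite -subr_ge0 -mulN1r -Rintegral_compactZ// -Rintegral_compactD//.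
rewrite (@Rintegral_compact_eq _ (fun x => `|g x + (- 1) * f x|))//.
- exact: Rintegral_ge0.
- exact: continuousR_norm.
- by move=> x xK; rewrite ger0_norm// mulN1r subr_ge0 fg.
Qed.

Lemma Rintegral_compact_norm f (M : R) : continuous f ->
  {in K, forall x, `|f x| <= M} -> `|\int[mu]_x f x| <= M.
Proof.
move=> cf fM; rewrite ler_norml; apply/andP; split.
- rewrite -[leLHS]Rintegral_compact_cst; apply: Rintegral_compact_le => //.
    exact: continuousR_cst.
  by move=> x xK; have := fM _ xK; rewrite ler_norml => /andP[].
- rewrite -[leRHS]Rintegral_compact_cst; apply: Rintegral_compact_le => //.
    exact: continuousR_cst.
  by move=> x xK; have := fM _ xK; rewrite ler_norml => /andP[].
Qed.

Hypothesis rmu : rotation_invariant mu.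

Lemma continuous_mulmx (Q : 'M[R]_m) :
  continuous (fun x : 'rV[R]_m => x *m Q : 'rV[R]_m).
Proof.
apply: continuous_rV => j.
rewrite (_ : (fun _ => _) = (fun x => dotp (\row_i Q i j) x)).
  exact: continuous_dotp.
by apply/funext => x; rewrite mxE; apply: eq_bigr => i _; rewrite mxE mulrC.
Qed.

Lemma Rintegral_rotation f (Q : 'M[R]_m) : continuous f ->
  Q *m Q^T = 1%:M -> \int[mu]_x f (x *m Q) = \int[mu]_x f x.
Proof.
move=> cf QQ; congr fine.
have mf : measurable_fun [set: borel_rV R m] (EFin \o f).
  by apply/measurable_EFinP; exact: continuous_borel_rV.
have intf : mu.-integrable setT (fun x => (f ((x : 'rV[R]_m) *m Q))%:E).
  apply: (integrable_compact (f := fun x => f (x *m Q))) => x.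
  apply: continuous_comp; [exact: continuous_mulmx|exact: cf].
have := @integral_pushforward _ _ _ _ _ _ (measurable_mulmx Q) mu setT _ mf.
rewrite preimage_setT => /(_ intf measurableT) <-.
apply: (@eq_measure_integral _ _ _ _ mu (push_measure (measurable_mulmx Q) mu)) => A mA _.
exact: rmu.
Qed.

End compact_support.

Lemma eq_Rintegral_rV (R : realType) (m : nat) (mu : probability (borel_rV R m) R)
    (f g : 'rV[R]_m -> R) :
  f =1 g -> \int[mu]_x f x = \int[mu]_x g x.
Proof. by move=> /funext ->. Qed.

(** * Moments of rotation-invariant laws *)

Section householder.
Context (R : realType) (m : nat).
Implicit Types u v x : 'rV[R]_m.

Definition householder v : 'M[R]_m := 1%:M - (2 / dotp v v) *: (v^T *m v).

Lemma mulmx_householder v x :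
  x *m householder v = x - (2 * dotp x v / dotp v v) *: v.
Proof.
rewrite /householder mulmxBr mulmx1 -scalemxAr mulmxA.
rewrite [x *m v^T]mx11_scalar -dotpE mul_scalar_mx scalerA.
by congr (_ - _ *: _); rewrite mulrAC.
Qed.

Lemma householder_orthogonal v : v != 0 ->
  householder v *m (householder v)^T = 1%:M.
Proof.
rewrite -dotp_eq0 => v0.
have -> : (householder v)^T = householder v.
  by rewrite /householder linearB/= linearZ/= trmx1 trmx_mul trmxK.
apply/row_matrixP => i; rewrite row_mul [X in X *m _]rowE !mulmx_householder row1.
rewrite dotpDl dotpNl dotpZl divfK//.
set w := delta_mx _ i; set a := dotp w v.
have -> : 2 * (a - 2 * a) / dotp v v = - (2 * a / dotp v v) by field.
by rewrite scaleNr opprK subrK.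
Qed.

Lemma dotp_householder v x : v != 0 -> dotp v (x *m householder v) = - dotp v x.
Proof.
rewrite -dotp_eq0 => v0; rewrite mulmx_householder dotpDr dotpNr dotpZr divfK//.
by rewrite dotpC; ring.
Qed.

Lemma dotp_householder_orth u v x : dotp u v = 0 ->
  dotp u (x *m householder v) = dotp u x.
Proof.
by move=> uv; rewrite mulmx_householder dotpDr dotpNr dotpZr uv mulr0 subr0.
Qed.

Lemma householder_enorm (j : 'I_m) x : x != enorm x *: delta_mx ord0 j ->
  x *m householder (x - enorm x *: delta_mx ord0 j) = enorm x *: delta_mx ord0 j.
Proof.
set e := delta_mx ord0 j; set v := x - _ => xe.
have v0 : dotp v v != 0 by rewrite dotp_eq0 subr_eq0.
have ee : dotp e e = 1 by rewrite dotp_delta mxE !eqxx.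
have vv : dotp v v = 2 * dotp x v.
  rewrite /v !(dotpDl, dotpDr, dotpNl, dotpNr, dotpZl, dotpZr) ee (dotpC e x).
  by rewrite -enorm_sqr; ring.
rewrite mulmx_householder -vv divff// scale1r /v opprB addrC subrK//.
Qed.

End householder.

Section rotation_invariant_moments.
Context (R : realType) (m : nat).
Variables (mu : probability (borel_rV R m) R) (K : set 'rV[R]_m).
Hypotheses (cK : compact K) (muK : mu (~` K) = 0%E).
Hypothesis rmu : rotation_invariant mu.
Implicit Types l v : 'rV[R]_m.

(** The reflection along v fixes <l,x> and changes the sign of <v,x>.  Applied
    below to the components of x orthogonal to l, this shows that Phi l is
    parallel to l. *)
Lemma integral_orth_odd l v (g : R -> R) : continuous g -> dotp l v = 0 ->
  \int[mu]_x (dotp v x * g (dotp l x)) = 0.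
Proof.
move=> cg lv; have [->|v0] := eqVneq v 0.
  rewrite (eq_Rintegral_rV _ (g := fun=> 0)) ?Rintegral_compact_cst// => x.
  by rewrite -(scale0r 0) dotpZl !mul0r.
have cf : continuous (fun x : 'rV[R]_m => dotp v x * g (dotp l x)).
  apply: continuousR_mul; first exact: continuous_dotp.
  move=> x; apply: continuous_comp; [exact: continuous_dotp|exact: cg].
have := Rintegral_rotation cK muK rmu cf (householder_orthogonal v0).
rewrite (eq_Rintegral_rV _ (g := fun x : 'rV[R]_m => (- 1) * (dotp v x * g (dotp l x)))).
  rewrite (Rintegral_compactZ cK muK)// mulN1r => /eqP.
  by rewrite eqNr => /eqP.
by move=> x; rewrite dotp_householder// dotp_householder_orth// mulN1r mulNr.
Qed.

Lemma integral_dotp_odd l k : odd k -> \int[mu]_x (dotp l x ^+ k) = 0.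
Proof.
move=> ok.
have cf : continuous (fun x : 'rV[R]_m => dotp l x ^+ k).
  by apply: continuousR_exp; exact: continuous_dotp.
have oN : (- 1%:M : 'M[R]_m) *m (- 1%:M)^T = 1%:M.
  by rewrite linearN/= trmx1 mulNmx mul1mx opprK.
have := Rintegral_rotation cK muK rmu cf oN.
rewrite (eq_Rintegral_rV _ (g := fun x : 'rV[R]_m => (- 1) * dotp l x ^+ k)).
  by rewrite (Rintegral_compactZ cK muK)// mulN1r => /eqP; rewrite eqNr => /eqP.
by move=> x; rewrite mulmxN mulmx1 dotpNr exprNn -signr_odd ok expr1.
Qed.

(** A reflection maps l to the multiple of a basis vector of the same length. *)
Lemma integral_dotp_exp (j : 'I_m) l k :
  \int[mu]_x (dotp l x ^+ k) = enorm l ^+ k * \int[mu]_x (x ord0 j ^+ k).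
Proof.
have cf (y : 'rV[R]_m) : continuous (fun x : 'rV[R]_m => dotp y x ^+ k).
  by apply: continuousR_exp; exact: continuous_dotp.
have cj : continuous (fun x : 'rV[R]_m => x ord0 j ^+ k).
  by apply: continuousR_exp => x; exact: coord_continuous.
rewrite -(Rintegral_compactZ cK muK)//.
have [le|le] := eqVneq l (enorm l *: delta_mx ord0 j).
  by apply: eq_Rintegral_rV => x; rewrite -exprMn -dotp_delta -dotpZl -le.
have ho : householder (l - enorm l *: delta_mx ord0 j) *m
    (householder (l - enorm l *: delta_mx ord0 j))^T = 1%:M.
  by apply: householder_orthogonal; rewrite subr_eq0.
rewrite -[RHS](Rintegral_rotation cK muK rmu _ ho); last exact: continuousR_scale.
apply: eq_Rintegral_rV => x; rewrite -exprMn -(dotp_mulmx l x ho).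
by rewrite (householder_enorm le) dotpZl dotp_delta.
Qed.

End rotation_invariant_moments.

Lemma coef2_oneDsqr_exp (R : comNzRingType) k :
  ((1 + 'X^2) ^+ k : {poly R})`_2 = k%:R.
Proof.
suff [] : ((1 + 'X^2) ^+ k : {poly R})`_2 = k%:R /\ ((1 + 'X^2) ^+ k : {poly R})`_0 = 1.
  by [].
elim: k => [|k [IH2 IH0]]; first by rewrite expr0 !coef1.
rewrite exprS mulrDl mul1r !coefD !coefXnM/= IH2 IH0 addr0; split=> //.
by rewrite -natr1.
Qed.

Lemma poly_eqP (R : realFieldType) (p q : {poly R}) :
  (forall x, p.[x] = q.[x]) -> p = q.
Proof.
move=> pq; apply/eqP; rewrite -subr_eq0; apply/eqP.
apply: (@roots_geq_poly_eq0 _ _ [seq i%:R | i <- iota 0 (size (p - q))]).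
- by apply/allP => x _; rewrite rootE !hornerE pq subrr.
- by rewrite map_inj_uniq ?iota_uniq// => i j /eqP; rewrite eqr_nat => /eqP.
- by rewrite size_map size_iota.
Qed.

Section sphere_moments.
Context (R : realType) (m : nat).
Variables (sigma : probability (borel_rV R m) R).
Hypotheses (rs : rotation_invariant sigma) (sK : sigma (~` @unit_sphere R m) = 0%E).
Variable j0 : 'I_m.

Lemma compact_unit_sphere : compact (@unit_sphere R m : set 'rV[R]_m).
Proof.
apply: bounded_closed_compact.
  exists 1; split => // x x1 y /= ys; apply: ltW.
  apply: le_lt_trans x1; rewrite /Num.norm/= mx_normrE.
  apply/bigmax_leP; split => // -[i j] _ /=.
  rewrite (ord1 i) -(expr_le1 (n := 2))// real_normK ?num_real//.
  by apply: le_trans (coord_sqr_le _ _) _; rewrite ys.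
rewrite (_ : @unit_sphere R m = (fun x : 'rV[R]_m => dotp x x) @^-1` [set 1]).
  by apply: closed_comp => [x _|]; [exact: continuous_sqnorm|exact: closed_eq].
by apply/seteqP; split.
Qed.
Let cK := compact_unit_sphere.

Definition sphere_moment k := \int[sigma]_x ((x : 'rV[R]_m) ord0 j0 ^+ k).

Lemma sphere_moment0 : sphere_moment 0 = 1.
Proof.
by rewrite /sphere_moment (eq_Rintegral_rV _ (g := fun=> 1)) ?Rintegral_compact_cst.
Qed.

Let ccoord (j : 'I_m) : continuous (fun x : 'rV[R]_m => x ord0 j).
Proof. by move=> x; exact: coord_continuous. Qed.

(** Compare the coefficients of e^2 in the moment of order 2k+2 of
    x_0 + e x_j, which is (1 + e^2)^(k+1) times the moment of x_0. *)
Lemma mixed_moment k (j : 'I_m) : j != j0 ->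
  (k.*2.+1)%:R * \int[sigma]_x (x ord0 j0 ^+ k.*2 * x ord0 j ^+ 2) =
  sphere_moment k.+1.*2.
Proof.
move=> jj0.
pose c i := \int[sigma]_x (x ord0 j0 ^+ (k.+1.*2 - i) * x ord0 j ^+ i).
pose p : {poly R} := \poly_(i < k.+1.*2.+1) (c i *+ 'C(k.+1.*2, i)).
pose q : {poly R} := sphere_moment k.+1.*2 *: (1 + 'X^2) ^+ k.+1.
have pq : p = q.
  apply: poly_eqP => e; rewrite horner_poly !hornerE.
  pose l : 'rV[R]_m := delta_mx ord0 j0 + e *: delta_mx ord0 j.
  have ll (x : 'rV[R]_m) : dotp l x = x ord0 j0 + e * x ord0 j.
    by rewrite dotpDl dotpZl !dotp_delta.
  have nl : dotp l l = 1 + e ^+ 2.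
    rewrite ll !mxE !eqxx (negbTE jj0) eq_sym (negbTE jj0) /=.
    by rewrite mulr0 addr0 mulr1 add0r -expr2.
  have := integral_dotp_exp cK sK rs j0 l k.+1.*2.
  rewrite -/(sphere_moment _) -mul2n exprM enorm_sqr nl mulrC mul2n => <-.
  rewrite (eq_Rintegral_rV _ (g := fun x : 'rV[R]_m => \sum_(i < k.+1.*2.+1)
     (e ^+ i *+ 'C(k.+1.*2, i)) * (x ord0 j0 ^+ (k.+1.*2 - i) * x ord0 j ^+ i))).
    rewrite (Rintegral_compact_sum cK sK); last first.
      by move=> i; apply/continuousR_scale/continuousR_mul; exact/continuousR_exp/ccoord.
    apply: eq_bigr => i _; rewrite (Rintegral_compactZ cK sK).
      by rewrite -/(c i) !mulrnAl mulrC.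
    by apply/continuousR_mul; exact/continuousR_exp/ccoord.
  move=> x; rewrite ll exprDn; apply: eq_bigr => i _.
  by rewrite exprMn mulrnAl; congr (_ *+ _); ring.
have := congr1 (fun r : {poly R} => r`_2) pq.
rewrite coef_poly coefZ coef2_oneDsqr_exp ltnS -[2%N]/(1.*2) leq_double/=.
rewrite /c (_ : (_ - 1.*2)%N = k.*2); last by rewrite -doubleB subSS subn0.
have -> : 'C(k.+1.*2, 2) = (k.+1 * k.*2.+1)%N.
  by rewrite bin2 -doubleMl doubleK doubleS.
set I := \int[_]_x _.
rewrite -[I *+ _]mulr_natr natrM => h.
have k0 : (k.+1)%:R != 0 :> R by rewrite pnatr_eq0.
by apply: (mulIf k0); rewrite -h; ring.
Qed.

(** Insert |x|^2 = 1 in the moment of order 2k and use mixed_moment for the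
    terms x_j^2 with j different from j0. *)
Lemma sphere_moment_rec k :
  (k.*2 + m)%:R * sphere_moment k.+1.*2 = (k.*2.+1)%:R * sphere_moment k.*2.
Proof.
have -> : sphere_moment k.*2 =
    \sum_(j < m) \int[sigma]_x (x ord0 j0 ^+ k.*2 * x ord0 j ^+ 2).
  rewrite -(Rintegral_compact_sum cK sK); last first.
    by move=> j; apply/continuousR_mul; exact/continuousR_exp/ccoord.
  apply: (Rintegral_compact_eq cK sK).
  - exact/continuousR_exp/ccoord.
  - by apply: continuousR_sum => j; apply/continuousR_mul; exact/continuousR_exp/ccoord.
  - move=> x /set_mem xs; rewrite -mulr_sumr.
    rewrite (_ : \sum_(i < m) _ = 1) ?mulr1//.
rewrite mulr_sumr (bigD1 j0)//=.
rewrite (eq_bigr (fun=> sphere_moment k.+1.*2)) => [|j jj0]; last exact: mixed_moment.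
rewrite sumr_const (eq_Rintegral_rV _ (g := fun x : 'rV[R]_m => x ord0 j0 ^+ k.+1.*2)).
  rewrite -/(sphere_moment _) -[sphere_moment _ *+ _]mulr_natl -mulrDl -natrD cardC1 card_ord.
  by congr (_%:R * _); rewrite addSn -addnS prednK// (leq_ltn_trans _ (ltn_ord j0)).
by move=> x; rewrite -exprD addn2.
Qed.

Lemma sphere_moment_gt0 k : 0 < sphere_moment k.*2.
Proof.
elim: k => [|k IH]; first by rewrite sphere_moment0.
have m0 : (0 < m)%N by case: (j0) => i; case: (m).
rewrite -(pmulr_rgt0 (x := (k.*2 + m)%:R)) ?ltr0n ?addn_gt0 ?m0 ?orbT//.
by rewrite sphere_moment_rec mulr_gt0.
Qed.

Lemma sphere_moment_prod k : sphere_moment k.*2 * \prod_(i < k) (m + i.*2)%:R =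
  \prod_(i < k) (i.*2.+1)%:R.
Proof.
elim: k => [|k IH]; first by rewrite !big_ord0 mulr1 sphere_moment0.
rewrite !big_ord_recr/= -IH; set p := \prod_(i < k) _.
have h := sphere_moment_rec k; rewrite addnC in h.
transitivity (p * ((m + k.*2)%:R * sphere_moment k.+1.*2)); first by ring.
by rewrite h; ring.
Qed.

End sphere_moments.

(** * A quadrature formula for Gaussian radial moments *)

Section spectral_measure.
Context (R : rcfType) (n : nat) (J : 'M[R]_n.+1).
Hypothesis Jsym : J^T = J.

(** The spectral measure of a real symmetric matrix at the first basis vector:
    diagonalise it over the complex numbers by a unitary matrix; the eigenvalues
    are real and the weights are the squared moduli of the first column. *)
Lemma spectral_measure : exists th w : 'I_n.+1 -> R, (forall i, 0 <= w i) /\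
  forall f : {poly R}, horner_mx J f ord0 ord0 = \sum_i w i * f.[th i].
Proof.
pose toC := real_complex R.
pose A : 'M[R[i]%C]_n.+1 := map_mx toC J.
have rC x : toC x \is Num.real by rewrite realE !lecE/= eqxx/= -realE num_real.
have Asym : A \is symmetricmx.
  by apply/is_hermitianmxP; rewrite expr0 scale1r map_mx_id// map_trmx Jsym.
have Areal : A \is a mxOver Num.real by apply/mxOverP => i j; rewrite mxE rC.
have Aherm := realsym_hermsym Asym Areal.
have /orthomx_spectralP AE := hermitian_normalmx Aherm.
have /mxOverP Xreal := hermitian_spectral_diag_real Aherm.
set P := spectralmx A in AE; set X := spectral_diag A in AE Xreal.
have Pu : P \is unitarymx := spectral_unitarymx A.
pose th i := complex.Re (X ord0 i); pose w i := complex.Re (`|P i ord0| ^+ 2).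
have thE i : toC (th i) = X ord0 i by rewrite /toC/th; apply: RRe_real.
have wE i : toC (w i) = `|P i ord0| ^+ 2.
  by rewrite /toC/w; apply: RRe_real; rewrite realX.
exists th, w; split=> [i|f].
  have : 0 <= toC (w i) by rewrite wE exprn_ge0.
  by rewrite lecE /= => /andP[].
apply: (@complexI R); rewrite rmorph_sum/=.
transitivity (horner_mx A (map_poly toC f) ord0 ord0).
  by rewrite -map_horner_mx mxE.
rewrite AE horner_mx_uconjC ?unitarymx_unit// horner_mx_diag invmx_unitary//.
rewrite mxE; apply: eq_bigr => i _.
rewrite mul_mx_diag !mxE rmorphM/= -/toC wE -thE horner_map/=.
by rewrite normCK mulrAC [P i ord0 * _]mulrC.
Qed.

End spectral_measure.

Section jacobi.
Context (R : rcfType) (m : nat).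
Hypothesis m_gt0 : (0 < m)%N.

(** The moments of |x|^2 for the standard Gaussian law on R^m. *)
Definition radial_moment k : R := \prod_(i < k) (m + i.*2)%:R.

Lemma radial_momentS k : radial_moment k.+1 = (m + k.*2)%:R * radial_moment k.
Proof. by rewrite /radial_moment big_ord_recr mulrC. Qed.

(** The recurrence coefficients h_(j+1) = x h_j - g_j h_(j-1) of the generalised
    Hermite polynomials, orthogonal for the even law on R whose moments of even
    order 2k are radial_moment k. *)
Definition jacobi_coef j : R := (if odd j then m + j.-1 else j)%:R.

Lemma jacobi_coef_ge0 j : 0 <= jacobi_coef j. Proof. exact: ler0n. Qed.

Lemma jacobi_coef_gt0 j : 0 < jacobi_coef j.+1.
Proof. by rewrite /jacobi_coef ltr0n; case: ifP => // _; rewrite addn_gt0 m_gt0. Qed.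

(** The coefficient of h_j in the expansion of x^k, computed through the
    recurrence x h_j = h_(j+1) + g_j h_(j-1). *)
Fixpoint hermite_coef k j : R :=
  if k is k'.+1 then
    (if j is j'.+1 then hermite_coef k' j' else 0) +
    jacobi_coef j.+1 * hermite_coef k' j.+1
  else (j == 0)%:R.

Lemma hermite_coefS k j : hermite_coef k.+1 j =
  (if j is j'.+1 then hermite_coef k j' else 0) +
    jacobi_coef j.+1 * hermite_coef k j.+1.
Proof. by []. Qed.

(** The closed form is 'C(k, j) M_k / M_j (even case), stated without division;
    the recurrence reduces it to Pascal's rule and
    (j+1) 'C(k, j+1) + j 'C(k, j) = k 'C(k, j). *)
Lemma hermite_coef_even_odd k :
  (forall j, hermite_coef k.*2 j.*2 * radial_moment j =
     'C(k, j)%:R * radial_moment k) /\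
  (forall j, hermite_coef k.*2.+1 j.*2.+1 * radial_moment j.+1 =
     'C(k, j)%:R * radial_moment k.+1).
Proof.
have stepO k' : (forall j, hermite_coef k'.*2 j.*2 * radial_moment j =
     'C(k', j)%:R * radial_moment k') ->
  (forall j, hermite_coef k'.*2.+1 j.*2.+1 * radial_moment j.+1 =
     'C(k', j)%:R * radial_moment k'.+1).
  move=> IH j; rewrite hermite_coefS mulrDl -doubleS -mulrA IH.
  rewrite {1}radial_momentS mulrCA IH /jacobi_coef odd_double radial_momentS.
  have h : (j.+1 * 'C(k', j.+1) + j * 'C(k', j) = k' * 'C(k', j))%N.
    have [jk|kj] := leqP j k'; last first.
      by rewrite (bin_small kj) (bin_small (leqW kj)) !muln0.
    by rewrite mul_bin_left -mulnDl subnK.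
  have {}h : j.+1%:R * 'C(k', j.+1)%:R + j%:R * 'C(k', j)%:R =
     k'%:R * 'C(k', j)%:R :> R by rewrite -!natrM -natrD h.
  rewrite !natrD -!muln2 !natrM.
  set M := radial_moment k'; set c := 'C(k', j)%:R in h *.
  set c' := 'C(k', j.+1)%:R in h *.
  transitivity (m%:R * (c * M) + 2 * (j.+1%:R * c' + j%:R * c) * M); first by ring.
  by rewrite h; ring.
have stepE k' : (forall j, hermite_coef k'.*2.+1 j.*2.+1 * radial_moment j.+1 =
     'C(k', j)%:R * radial_moment k'.+1) ->
  (forall j, hermite_coef k'.+1.*2 j.*2 * radial_moment j =
     'C(k'.+1, j)%:R * radial_moment k'.+1).
  move=> IH j; rewrite doubleS hermite_coefS mulrDl.
  have -> : jacobi_coef j.*2.+1 * hermite_coef k'.*2.+1 j.*2.+1 * radial_moment j =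
      'C(k', j)%:R * radial_moment k'.+1.
    by rewrite -IH radial_momentS /jacobi_coef /= odd_double/=; ring.
  case: j => [|j]; first by rewrite !bin0 mul0r add0r.
  by rewrite doubleS IH binS natrD mulrDl addrC.
elim: k => [|k [_ IHo]]; last by split; [exact: stepE|exact/stepO/stepE].
have base j : hermite_coef 0.*2 j.*2 * radial_moment j = 'C(0, j)%:R * radial_moment 0.
  case: j => [|j]; first by rewrite bin0.
  by rewrite bin0n doubleS /= !mul0r.
by split; [exact: base|exact: stepO].
Qed.

Lemma hermite_coef_even0 k : hermite_coef k.*2 0 = radial_moment k.
Proof.
have [/(_ 0) + _] := hermite_coef_even_odd k.
by rewrite bin0 mul1r [radial_moment 0]big_ord0 mulr1.
Qed.

Lemma hermite_coef_gt k j : (k < j)%N -> hermite_coef k j = 0.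
Proof.
elim: k j => [|k IH] [|j]// kj.
by rewrite hermite_coefS !IH ?mulr0 ?addr0// ltnW// ltnW.
Qed.

Lemma hermite_coef_lead k : hermite_coef k k = 1.
Proof.
elim: k => [//|k IH].
by rewrite hermite_coefS IH hermite_coef_gt ?mulr0 ?addr0// ltnW.
Qed.

Section truncated.
Variable N : nat.

Definition jacobi : 'M[R]_N.+1 := \matrix_(i, j)
  (if j == i.+1 :> nat then Num.sqrt (jacobi_coef j)
   else if i == j.+1 :> nat then Num.sqrt (jacobi_coef i) else 0).

Lemma jacobi_sym : jacobi^T = jacobi.
Proof.
apply/matrixP => i j; rewrite !mxE.
case: eqP => [->|]; last by case: eqP.
by case: eqP => //; clear m_gt0; lia.
Qed.

(** The norm of h_j. *)
Definition jacobi_norm j : R := \prod_(i < j) Num.sqrt (jacobi_coef i.+1).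

(** The truncated matrix represents the multiplication by x in the orthonormal
    basis of the h_j as long as degrees do not exceed N. *)
Lemma jacobi_row k : (k <= N)%N -> forall j : 'I_N.+1,
  (jacobi ^+ k) ord0 j = hermite_coef k j * jacobi_norm j.
Proof.
elim: k => [|k IH] kN j.
  rewrite expr0 mxE /= eq_sym.
  case: eqP => [->|j0]; first by rewrite eqxx /jacobi_norm big_ord0 mulr1.
  by case: eqP => [j0'|]; rewrite ?mul0r//; case: j0; apply: val_inj.
rewrite exprSr mxE hermite_coefS mulrDl.
rewrite (eq_bigr (fun i : 'I_N.+1 =>
   (if j == i.+1 :> nat then hermite_coef k i * jacobi_norm i * Num.sqrt (jacobi_coef j) else 0)
   + (if i == j.+1 :> nat then hermite_coef k i * jacobi_norm i * Num.sqrt (jacobi_coef i) else 0))); last first.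
  move=> i _; rewrite IH 1?ltnW// mxE.
  case: eqP => [ji|_]; case: eqP => [ij|_]; rewrite ?mulr0 ?addr0 ?add0r//.
  by exfalso; clear m_gt0; lia.
rewrite big_split/= -!big_mkcond/=; congr (_ + _).
  case: (val j) (ltn_ord j) => [|j'] jN; first by rewrite big_pred0 ?mul0r.
  have jN' : (j' < N.+1)%N by exact: ltnW.
  rewrite (big_pred1 (Ordinal jN')) => [|i]; last first.
    by rewrite /= eqSS eq_sym; apply/eqP/eqP => [h|->//]; apply: val_inj.
  by rewrite /= -mulrA; congr (_ * _); rewrite /jacobi_norm big_ord_recr.
have [jN|jN] := ltnP j.+1 N.+1.
  rewrite (big_pred1 (Ordinal jN)) => [|i]; last first.
    by apply/eqP/eqP => [h|->//]; apply: val_inj.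
  rewrite /= /jacobi_norm big_ord_recr/=; set p := \prod_(i < j) _.
  transitivity (Num.sqrt (jacobi_coef j.+1) ^+ 2 * hermite_coef k j.+1 * p); first by ring.
  by rewrite sqr_sqrtr// jacobi_coef_ge0.
rewrite hermite_coef_gt ?mulr0 ?mul0r; last exact: (leq_trans kN (ltnW jN)).
by rewrite big_pred0// => i; apply/eqP => ij; have := ltn_ord i; rewrite ij ltnNge jN.
Qed.

End truncated.
End jacobi.

Section quadrature.
Context (R : rcfType) (m n : nat).
Hypothesis m_gt0 : (0 < m)%N.

(** The quadrature formula integrates f as the entry (0,0) of f(J).  The last
    property says that the law is not concentrated on the zeros of a polynomial
    of degree n in x^2: the integral of p(x^2)^2 is the squared length of the
    first row of p(J^2), whose entry of index 2 deg p is the leading coefficient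
    of p up to a positive factor.  The size 2n+1 is what this entry requires. *)
Lemma quadrature_exists : exists (N : nat) (th w : 'I_N -> R),
  [/\ forall i, 0 <= w i,
     forall k, (k <= n)%N -> \sum_i w i * (th i ^+ 2) ^+ k = radial_moment R m k &
     forall p : {poly R}, (size p <= n.+1)%N ->
       \sum_i w i * p.[th i ^+ 2] ^+ 2 = 0 -> p = 0].
Proof.
pose J := jacobi R m n.*2.
have [th [w [w_ge0 wE]]] := spectral_measure (jacobi_sym R m n.*2).
exists n.*2.+1, th, w; split=> // [k kn|p pn].
  under eq_bigr do rewrite -exprM mul2n -hornerXn.
  rewrite -wE rmorphXn/= horner_mx_X jacobi_row ?leq_double//.
  by rewrite hermite_coef_even0// /jacobi_norm big_ord0 mulr1.
pose B := horner_mx J (p \Po 'X^2).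
have BE : B = \sum_(k < size p) p`_k *: J ^+ k.*2.
  rewrite /B comp_polyE rmorph_sum/=; apply: eq_bigr => k _.
  by rewrite linearZ/= -exprM rmorphXn/= horner_mx_X mul2n.
have BT : B^T = B.
  rewrite BE linear_sum; apply: eq_bigr => k _; rewrite linearZ/=; congr (_ *: _).
  elim: (k.*2) => [|l IH]; first by rewrite expr0 trmx1.
  by rewrite [in LHS]exprS trmx_mul IH jacobi_sym [in RHS]exprSr.
have -> : \sum_i w i * p.[th i ^+ 2] ^+ 2 = \sum_j B ord0 j ^+ 2.
  rewrite (eq_bigr (fun i => w i * ((p \Po 'X^2) ^+ 2).[th i])) => [|i _]; last first.
    by rewrite horner_exp horner_comp hornerXn.
  rewrite -wE rmorphXn/= -/B expr2 mxE; apply: eq_bigr => j _.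
  by rewrite -{2}BT mxE expr2.
move=> B0; have {}B0 j : B ord0 j = 0.
  have /psumr_eq0P : \sum_j B ord0 j ^+ 2 = 0 by exact: B0.
  by move=> /(_ (fun i _ => sqr_ge0 (B ord0 i)) j isT)/eqP; rewrite sqrf_eq0 => /eqP.
apply/eqP/negPn/negP => p0.
pose d := (size p).-1.
have dn : (d <= n)%N by rewrite /d; case: (size p) pn.
have dN : (d.*2 < n.*2.+1)%N by rewrite ltnS leq_double.
have := B0 (Ordinal dN).
have dp : (d < size p)%N by rewrite /d prednK// lt0n size_poly_eq0.
rewrite BE summxE (bigD1 (Ordinal dp))//=.
rewrite big1 => [|k]; last first.
  rewrite -val_eqE /= => kd.
  have kd' : (k < d)%N.
    rewrite ltn_neqAle kd -ltnS.
    by rewrite /d (prednK (leq_trans (ltn0Sn d) dp)) ltn_ord.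
  rewrite mxE jacobi_row ?leq_double ?(leq_trans (ltnW kd') dn)//.
  by rewrite hermite_coef_gt ?mul0r ?mulr0//= ltn_double.
rewrite addr0 mxE jacobi_row ?leq_double//= hermite_coef_lead mul1r => /eqP.
rewrite mulf_eq0 -/(lead_coef p) lead_coef_eq0 (negbTE p0)/= => /eqP.
apply/eqP; rewrite /jacobi_norm; apply/prodf_neq0 => i _.
by rewrite gt_eqF// sqrtr_gt0 jacobi_coef_gt0.
Qed.

End quadrature.

Section dual_weights.
Context (R : rcfType) (m n : nat).
Hypothesis m_gt0 : (0 < m)%N.

(** Changing the weights w_i to w_i (1 + d_0 psi_0(i) + ... + d_n psi_n(i)) adds
    d_k to the moment of order k.  The psi_k are the basis of polynomials dual to
    the powers for the quadrature formula, given by the inverse of its Gram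
    matrix, which is invertible since it is positive definite. *)
Lemma dual_quadrature_exists : exists (N : nat) (t w : 'I_N -> R)
    (psi : 'I_n.+1 -> 'I_N -> R),
  [/\ forall i, 0 <= t i, forall i, 0 <= w i,
     forall k, (k <= n)%N -> \sum_i w i * t i ^+ k = radial_moment R m k &
     forall j k : 'I_n.+1, \sum_i w i * psi k i * t i ^+ j = (j == k)%:R].
Proof.
have [N [th [w [w_ge0 wM wdef]]]] := quadrature_exists R n m_gt0.
pose t i := th i ^+ 2.
pose A : 'M[R]_n.+1 := \matrix_(j, k) \sum_i w i * t i ^+ (j + k).
have Au : A \in unitmx.
  rewrite -row_free_unit; apply/inj_row_free => v vA.
  pose p : {poly R} := rVpoly v.
  have pE i : p.[t i] = \sum_j v ord0 j * t i ^+ j.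
    rewrite /p (horner_coef_wide _ (size_poly _ _)).
    by apply: eq_bigr => j _; rewrite coef_rVpoly_ord.
  have : p = 0.
    apply: wdef; first exact: size_poly.
    have vAv : \sum_j (v *m A) ord0 j * v ord0 j = 0.
      by rewrite vA big1// => j _; rewrite mxE mul0r.
    rewrite -[RHS]vAv; under eq_bigr do rewrite -/(t _) pE expr2 mulr_suml mulr_sumr.
    rewrite exchange_big/=; apply: eq_bigr => j _.
    rewrite mxE mulr_suml.
    under eq_bigr do rewrite mulr_sumr mulr_sumr.
    rewrite exchange_big/=; apply: eq_bigr => k _.
    rewrite mxE mulr_sumr mulr_suml; apply: eq_bigr => i _.
    by rewrite exprD; ring.
  by move=> /(congr1 (@poly_rV R n.+1)); rewrite rVpolyK linear0.
exists N, t, w, (fun k i => \sum_j invmx A k j * t i ^+ j); split => //.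
- by move=> i; exact: sqr_ge0.
- move=> j k; have := congr1 (fun B : 'M[R]_n.+1 => B k j) (mulVmx Au).
  rewrite !mxE eq_sym => <-.
  under eq_bigr do rewrite mulr_sumr mulr_suml.
  rewrite exchange_big/=; apply: eq_bigr => l _.
  rewrite mxE mulr_sumr; apply: eq_bigr => i _.
  by rewrite exprD; ring.
Qed.

End dual_weights.

(** * Mixtures of uniform laws on spheres *)

Section mixture.
Context (R : realType) (m : nat).
Variables (sigma : probability (borel_rV R m) R).
Hypotheses (rs : rotation_invariant sigma) (sK : sigma (~` @unit_sphere R m) = 0%E).

Definition euclid_ball (rho : R) : set 'rV[R]_m := [set x | dotp x x <= rho ^+ 2].

Lemma compact_euclid_ball rho : compact (euclid_ball rho).
Proof.
apply: bounded_closed_compact.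
  exists `|rho|; split; first exact: num_real.
  move=> x x1 y /= ys; apply: ltW; apply: le_lt_trans x1.
  rewrite (_ : `|y| = mx_norm y)// mx_normrE.
  apply/bigmax_leP; split => // -[i j] _ /=.
  rewrite (ord1 i) -(ler_pXn2r (n := 2)) ?nnegrE ?normr_ge0//.
  rewrite !real_normK ?num_real//; exact: le_trans (coord_sqr_le _ _) ys.
rewrite (_ : euclid_ball rho = (fun x : 'rV[R]_m => dotp x x) @^-1` [set y | y <= rho ^+ 2])//.
by apply: closed_comp => [x _|]; [exact: continuous_sqnorm|exact: closed_le].
Qed.

Lemma continuous_scale (r : R) : continuous (fun x : 'rV[R]_m => r *: x).
Proof.
apply: continuous_rV => j.
rewrite (_ : (fun _ => _) = (fun t : 'rV[R]_m => r * t ord0 j)).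
  by apply: continuousR_scale => x; exact: coord_continuous.
by apply/funext => x; rewrite mxE.
Qed.

Lemma measurable_scale (r : R) : measurable_fun [set: borel_rV R m]
  ((fun x : 'rV[R]_m => r *: x) : borel_rV R m -> borel_rV R m).
Proof.
apply: measurable_fun_rV => j.
apply: (continuous_borel_rV (f := fun x : 'rV[R]_m => (r *: x) ord0 j)).
rewrite (_ : (fun _ => _) = (fun t : 'rV[R]_m => r * t ord0 j)).
  by apply: continuousR_scale => x; exact: coord_continuous.
by apply/funext => x; rewrite mxE.
Qed.

(** The law is the sum of the images of w_i sigma by the dilations of ratio r_i. *)
Lemma mixture_exists (N : nat) (r w : 'I_N -> R) (rho : R) :
  (forall i, 0 <= w i) -> \sum_i w i = 1 -> (forall i, `|r i| <= rho) ->
  exists mu : probability (borel_rV R m) R,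
  [/\ rotation_invariant mu, mu (~` euclid_ball rho) = 0%E &
    forall f : 'rV[R]_m -> R, continuous f ->
      \int[mu]_x f x = \sum_i w i * \int[sigma]_x f (r i *: (x : 'rV[R]_m))].
Proof.
move=> w_ge0 w_sum r_rho.
pose nu i : {measure set (borel_rV R m) -> \bar R} :=
  mscale (NngNum (w_ge0 i)) (push_measure (measurable_scale (r i)) sigma).
pose nun (k : nat) : {measure set (borel_rV R m) -> \bar R} :=
  if insub k is Some i then nu i else mzero.
pose M : {measure set (borel_rV R m) -> \bar R} := msum nun N.
have ME A : M A = (\sum_(i < N) (w i)%:E *
    sigma ((fun x : 'rV[R]_m => r i *: x) @^-1` A))%E.
  rewrite /M /= /msum; apply: eq_bigr => i _.
  by rewrite /nun valK.
have [mu muE] : exists mu : probability (borel_rV R m) R, (mu : set _ -> _) = M.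
  apply: probability_repack; rewrite ME.
  under eq_bigr do rewrite preimage_setT probability_setT mule1.
  by rewrite sumEFin w_sum.
have mB : measurable (euclid_ball rho : set (borel_rV R m)).
  exact: (measurable_compact (@compact_euclid_ball rho)).
have mS : measurable (@unit_sphere R m).
  exact: (measurable_compact (@compact_unit_sphere R m)).
have mu0 : mu (~` euclid_ball rho) = 0%E.
  rewrite muE ME big1// => i _.
  rewrite (_ : sigma _ = 0%E) ?mule0//; apply/eqP; rewrite -measure_le0 -sK.
  apply: le_measure; rewrite ?inE.
  - rewrite -[X in measurable X]setTI; apply: measurable_scale => //.
    exact: measurableC.
  - exact: measurableC.
  - move=> x /= xb xs; apply: xb; rewrite /euclid_ball /= dotpZl dotpZr mulrA -expr2.
    rewrite (_ : dotp _ _ = 1) ?mulr1//.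
    by rewrite -[X in X <= _]real_normK ?num_real// lerXn2r ?nnegrE// (le_trans _ (r_rho i)).
exists mu; split => //.
  move=> Q A QQ mA; rewrite muE !ME; apply: eq_bigr => i _; congr (_ * _)%E.
  rewrite -[RHS](rs QQ); last first.
    by rewrite -[X in measurable X]setTI; exact: measurable_scale.
  by congr (sigma _); apply/funext => x; rewrite /preimage/= scalemxAl.
move=> f cf.
have mf : measurable_fun [set: borel_rV R m] (EFin \o f).
  by apply/measurable_EFinP; exact: continuous_borel_rV.
have cfr i : continuous (fun x : 'rV[R]_m => f (r i *: x)).
  by move=> x; apply: continuous_comp; [exact: continuous_scale|exact: cf].
have If i : sigma.-integrable setT (fun x : borel_rV R m => (f (r i *: (x : 'rV[R]_m)))%:E).
  exact: (integrable_compact (@compact_unit_sphere R m) sK (cfr i)).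
have If' : mu.-integrable setT (EFin \o f).
  exact: (integrable_compact (@compact_euclid_ball rho) mu0 cf).
have ME' (h : borel_rV R m -> \bar R) : measurable_fun setT h -> (forall x, 0 <= h x)%E ->
    (\int[mu]_x h x = \sum_(i < N) (w i)%:E * \int[sigma]_x h (r i *: (x : 'rV[R]_m)))%E.
  move=> mh h0; transitivity (\int[M]_x h x)%E.
    by apply: eq_measure_integral => A mA _; rewrite -muE.
  rewrite ge0_integral_measure_sum//; apply: eq_bigr => i _.
  rewrite /nun valK /nu ge0_integral_mscale//=; congr (_ * _)%E.
  rewrite (ge0_integral_pushforward (measurable_scale (r i)))//.
pose a i := fine (\int[sigma]_x ((EFin \o f)^\+ (r i *: (x : 'rV[R]_m))))%E.
pose c i := fine (\int[sigma]_x ((EFin \o f)^\- (r i *: (x : 'rV[R]_m))))%E.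
have aE i : (\int[sigma]_x ((EFin \o f)^\+ (r i *: (x : 'rV[R]_m))) = (a i)%:E)%E.
  rewrite fineK//; have := integrable_pos_fin_num measurableT (If i).
  by congr (_ \is a fin_num); apply: eq_integral => x _; rewrite !funeposE.
have cE i : (\int[sigma]_x ((EFin \o f)^\- (r i *: (x : 'rV[R]_m))) = (c i)%:E)%E.
  rewrite fineK//; have := integrable_neg_fin_num measurableT (If i).
  by congr (_ \is a fin_num); apply: eq_integral => x _; rewrite !funenegE.
rewrite /Rintegral integralE !ME'//; first last.
- exact: measurable_funepos.
- exact: measurable_funeneg.
under eq_bigr do rewrite aE -EFinM.
under [X in (_ - X)%E]eq_bigr do rewrite cE -EFinM.
rewrite !sumEFin -EFinB /= -sumrB; apply: eq_bigr => i _.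
rewrite -mulrBr; congr (_ * _).
rewrite integralE -[a i - c i]/(fine (_%:E)) EFinB -aE -cE.
congr (fine (_ - _)%E); apply: eq_integral => x _; rewrite ?funeposE//.
by rewrite !funenegE.
Qed.

End mixture.

(** * The expansion of Phi at the origin *)

Lemma expR_partial_le (R : realType) (x : R) N : 0 <= x ->
  \sum_(0 <= k < N) x ^+ k / k`!%:R <= expR x.
Proof.
move=> x0; rewrite (_ : \sum_(_ <= _ < _) _ = series (exp_coeff x) N); last first.
  by rewrite /series/=; apply: eq_bigr => k _; rewrite exp_coeffE mulrC.
apply: nondecreasing_cvgn_le; last exact: is_cvg_series_exp_coeff.
apply/nondecreasing_seqP => k; rewrite /series/= big_nat_recr//= lerDl.
exact: exp_coeff_ge0.
Qed.

Lemma expR_taylor (R : realType) (z : R) p :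
  `|expR z - \sum_(0 <= k < p) z ^+ k / k`!%:R| <= expR `|z| * `|z| ^+ p.
Proof.
set S := \sum_(_ <= _ < _) _.
pose u N : R := `|series (exp_coeff z) N - S|.
have uc : u N @[N --> \oo] --> `|expR z - S|.
  apply: cvg_norm; apply: cvgB; last exact: cvg_cst.
  exact: is_cvg_series_exp_coeff.
rewrite -(cvg_lim _ uc)//; apply: limr_le; first by apply/cvg_ex; exists `|expR z - S|.
near=> N; have pN : (p <= N)%N by near: N; exact: nbhs_infty_ge.
rewrite /u (_ : series _ N = \sum_(0 <= k < N) z ^+ k / k`!%:R); last first.
  by rewrite /series/=; apply: eq_bigr => k _; rewrite exp_coeffE mulrC.
rewrite (big_cat_nat _ pN)//= -/S addrAC subrr add0r.
apply: le_trans (ler_norm_sum _ _ _) _.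
rewrite -{1}(add0n p) big_addn mulrC.
apply: (le_trans _ (ler_wpM2l _ (expR_partial_le (N - p) (normr_ge0 z)))); last first.
  by rewrite exprn_ge0.
rewrite mulr_sumr; apply: ler_sum => k _.
rewrite normrM normrX normfV (ger0_norm (ler0n _ _)) addnC exprD -mulrA.
rewrite ler_wpM2l ?exprn_ge0// ler_wpM2l ?exprn_ge0//.
rewrite lef_pV2 ?posrE ?ltr0n ?fact_gt0// ler_nat.
by apply: leq_fact; rewrite leq_addl.
Unshelve. all: by end_near. Qed.

Lemma big_even_odd (R : zmodType) (f : nat -> R) N :
  \sum_(0 <= k < N.*2) f k = \sum_(0 <= j < N) (f j.*2 + f j.*2.+1).
Proof.
elim: N => [|N IH]; first by rewrite !big_geq.
by rewrite doubleS !big_nat_recr//= IH addrA.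
Qed.

Lemma poly_vanishing_bound (R : realFieldType) (Q : {poly R}) n :
  (forall i, (i <= n)%N -> Q`_i = 0) ->
  exists2 c, 0 <= c & forall u, 0 <= u <= 1 -> `|Q.[u]| <= c * u ^+ n.+1.
Proof.
move=> Q0; exists (\sum_(i < size Q) `|Q`_i|); first by apply: sumr_ge0.
move=> u /andP[u0 u1]; rewrite horner_coef mulr_suml.
apply: le_trans (ler_norm_sum _ _ _) _; apply: ler_sum => i _.
have [ni|ni] := leqP i n; first by rewrite Q0// mul0r normr0 mul0r.
rewrite normrM; apply: ler_wpM2l; first exact: normr_ge0.
by rewrite ger0_norm ?exprn_ge0// ler_wiXn2l.
Qed.

(** In this section, G l and M l are the integrals of exp(beta <l,x>) and of
    <l,x> exp(beta <l,x>), and g k is the coefficient of |l|^(2k) in G. *)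
Section Phi_expansion_of_moments.
Context (R : realType) (m : nat).
Variables (mu : probability (borel_rV R m) R) (rho : R).
Hypotheses (rho_ge0 : 0 <= rho) (muK : mu (~` @euclid_ball R m rho) = 0%E).
Hypothesis rmu : rotation_invariant mu.
Variables (j0 : 'I_m) (beta : R).
Hypothesis beta_gt0 : 0 < beta.
Implicit Types l x : 'rV[R]_m.

Let cK := @compact_euclid_ball R m rho.

Lemma enorm_exp l k : enorm l ^+ k.*2 = dotp l l ^+ k.
Proof. by rewrite -mul2n exprM enorm_sqr. Qed.

(** A crude form of the Cauchy-Schwarz inequality, sufficient for Taylor
    remainders. *)
Lemma dotp_bound l x : euclid_ball rho x -> `|dotp l x| <= m%:R * rho * enorm l.
Proof.
move=> xr; apply: le_trans (ler_norm_sum _ _ _) _.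
rewrite -mulrA mulr_natl -[X in _ *+ X](card_ord m) -sumr_const.
apply: ler_sum => i _; rewrite normrM mulrC; apply: ler_pM => //.
  rewrite -(ler_pXn2r (n := 2)) ?nnegrE// real_normK ?num_real//.
  exact: le_trans (coord_sqr_le _ _) xr.
rewrite -(ler_pXn2r (n := 2)) ?nnegrE ?enorm_ge0// real_normK ?num_real//.
by rewrite enorm_sqr coord_sqr_le.
Qed.

Let G l := \int[mu]_x expR (beta * dotp l x).
Let M l := \int[mu]_x (dotp l x * expR (beta * dotp l x)).
Let S k := \int[mu]_x ((x : 'rV[R]_m) ord0 j0 ^+ k.*2).
Let g k := beta ^+ k.*2 * S k / (k.*2)`!%:R.

Let cdot l : continuous (fun x : 'rV[R]_m => dotp l x).
Proof. exact: continuous_dotp. Qed.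

Let cexp l : continuous (fun x : 'rV[R]_m => expR (beta * dotp l x)).
Proof. exact/continuousR_expR/continuousR_scale. Qed.

Lemma integral_dotp_even l k : \int[mu]_x (dotp l x ^+ k.*2) = S k * dotp l l ^+ k.
Proof. by rewrite (integral_dotp_exp cK muK rmu j0) enorm_exp mulrC. Qed.

(** Since exp z >= 1 + z and the first moments vanish. *)
Lemma G_ge1 l : 1 <= G l.
Proof.
have -> : 1 = \int[mu]_x (1 + beta * dotp l x) :> R.
  rewrite (Rintegral_compactD cK muK); [|exact: continuousR_cst|exact: continuousR_scale].
  rewrite Rintegral_compact_cst (Rintegral_compactZ cK muK)//.
  have := integral_dotp_odd cK muK rmu l (k := 1) isT.
  by rewrite (eq_Rintegral_rV _ (g := dotp l)) => [->|x]; rewrite ?expr1// mulr0 addr0.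
apply: (Rintegral_compact_le cK muK).
- by apply: continuousR_add; [exact: continuousR_cst|exact: continuousR_scale].
- exact: cexp.
- by move=> x _; exact: expR_ge1Dx.
Qed.

Let B := m%:R * rho.
Let B_ge0 : 0 <= B. Proof. by rewrite mulr_ge0. Qed.

Lemma taylor_dotp l x p : dotp l l <= 1 -> euclid_ball rho x ->
  `|expR (beta * dotp l x) - \sum_(0 <= k < p) (beta * dotp l x) ^+ k / k`!%:R|
  <= expR (beta * B) * (beta * B) ^+ p * enorm l ^+ p.
Proof.
move=> l1 xr; apply: le_trans (expR_taylor _ _) _.
have h : `|beta * dotp l x| <= beta * B * enorm l.
  by rewrite normrM gtr0_norm// -mulrA ler_pM2l// dotp_bound.
have e1 : enorm l <= 1 by rewrite -(expr_le1 (n := 2)) ?enorm_ge0// enorm_sqr.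
rewrite -mulrA -exprMn; apply: ler_pM; rewrite ?expR_ge0 ?exprn_ge0//.
  rewrite ler_expR; apply: le_trans h _.
  by rewrite ler_piMr// mulr_ge0// ltW.
by apply: lerXn2r => //; rewrite nnegrE ?(le_trans _ h).
Qed.

Lemma G_expansion n : exists2 c, 0 <= c & forall l, dotp l l <= 1 ->
  `|G l - \sum_(0 <= k < n.+1) g k * dotp l l ^+ k| <= c * dotp l l ^+ n.+1.
Proof.
exists (expR (beta * B) * (beta * B) ^+ n.+1.*2).
  by rewrite mulr_ge0 ?expR_ge0// exprn_ge0// mulr_ge0// ltW.
move=> l l1.
have cP : continuous (fun x : 'rV[R]_m =>
    \sum_(0 <= k < n.+1.*2) (beta ^+ k / k`!%:R) * dotp l x ^+ k).
  by apply: continuousR_sum => k; apply: continuousR_scale; exact: continuousR_exp.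
have -> : \sum_(0 <= k < n.+1) g k * dotp l l ^+ k =
    \int[mu]_x (\sum_(0 <= k < n.+1.*2) (beta ^+ k / k`!%:R) * dotp l x ^+ k).
  rewrite (Rintegral_compact_sum cK muK) ?big_even_odd; last first.
    by move=> k; apply: continuousR_scale; exact: continuousR_exp.
  apply: eq_bigr => k _; rewrite !(Rintegral_compactZ cK muK); try exact: continuousR_exp.
  rewrite integral_dotp_even (integral_dotp_odd cK muK rmu)/= ?odd_double//.
  by rewrite mulr0 addr0 /g; ring.
rewrite /G -RintegralB//; try exact: (integrable_compact cK muK).
rewrite -enorm_exp; apply: (Rintegral_compact_norm cK muK).
  rewrite (_ : (fun x => _) = (fun x => expR (beta * dotp l x) + (-1) *
    (\sum_(0 <= k < n.+1.*2) (beta ^+ k / k`!%:R) * dotp l x ^+ k))).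
    by apply: continuousR_add => //; exact: continuousR_scale.
  by apply/funext => x; rewrite mulN1r.
move=> x /set_mem xr; have := taylor_dotp n.+1.*2 l1 xr.
congr (`|_ - _| <= _); apply: eq_bigr => k _.
by rewrite exprMn mulrAC.
Qed.

Lemma M_expansion n : exists2 c, 0 <= c & forall l, dotp l l <= 1 ->
  `|M l - \sum_(0 <= k < n.+1) (k.*2)%:R / beta * g k * dotp l l ^+ k| <=
  c * dotp l l ^+ n.+1.
Proof.
exists (B * (expR (beta * B) * (beta * B) ^+ n.*2.+1)).
  by rewrite mulr_ge0// mulr_ge0 ?expR_ge0// exprn_ge0// mulr_ge0// ltW.
move=> l l1; have b0 : beta != 0 by rewrite gt_eqF.
(* The shift of index in <l,x> exp(beta <l,x>) is absorbed in the factor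
   k / beta, which vanishes at k = 0. *)
pose h k x := (k%:R / beta * (beta ^+ k / k`!%:R)) * dotp l x ^+ k.
have ch k : continuous (h k) by apply: continuousR_scale; exact: continuousR_exp.
have cP : continuous (fun x : 'rV[R]_m => \sum_(0 <= k < n.+1.*2) h k x).
  exact: continuousR_sum.
have cM : continuous (fun x : 'rV[R]_m => dotp l x * expR (beta * dotp l x)).
  exact: continuousR_mul.
have -> : \sum_(0 <= k < n.+1) (k.*2)%:R / beta * g k * dotp l l ^+ k =
    \int[mu]_x (\sum_(0 <= k < n.+1.*2) h k x).
  rewrite (Rintegral_compact_sum cK muK)// big_even_odd.
  apply: eq_bigr => k _; rewrite !(Rintegral_compactZ cK muK); try exact: continuousR_exp.
  rewrite integral_dotp_even (integral_dotp_odd cK muK rmu)/= ?odd_double//.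
  by rewrite mulr0 addr0 /g; ring.
rewrite /M -RintegralB//; try exact: (integrable_compact cK muK).
rewrite -enorm_exp; apply: (Rintegral_compact_norm cK muK).
  rewrite (_ : (fun x => _) = (fun x => dotp l x * expR (beta * dotp l x) + (-1) *
    (\sum_(0 <= k < n.+1.*2) h k x))).
    by apply: continuousR_add => //; exact: continuousR_scale.
  by apply/funext => x; rewrite mulN1r.
move=> x /set_mem xr; have := taylor_dotp n.*2.+1 l1 xr.
have -> : \sum_(0 <= k < n.+1.*2) h k x = dotp l x *
    \sum_(0 <= k < n.*2.+1) (beta * dotp l x) ^+ k / k`!%:R.
  rewrite doubleS big_nat_recl// {1}/h !mul0r add0r mulr_sumr.
  apply: eq_bigr => k _; rewrite /h factS natrM exprMn !exprS.
  have k0 : k.+1%:R != 0 :> R by rewrite pnatr_eq0.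
  have f0 : k`!%:R != 0 :> R by rewrite pnatr_eq0 -lt0n fact_gt0.
  by field; rewrite f0 b0 nat1r k0.
rewrite -mulrBr normrM => t; apply: le_trans (ler_pM _ _ (dotp_bound l xr) t) _ => //.
rewrite le_eqVlt; apply/orP; left; apply/eqP.
by rewrite doubleS !exprS /B; ring.
Qed.

(** The component of the basis vector orthogonal to l contributes nothing, by
    integral_orth_odd. *)
Lemma Phi_coordE l j : l != 0 ->
  \int[mu]_x ((x : 'rV[R]_m) ord0 j * expR (beta * dotp l x)) =
  M l / dotp l l * l ord0 j.
Proof.
move=> l0; have u0 : dotp l l != 0 by rewrite dotp_eq0.
pose v : 'rV[R]_m := delta_mx ord0 j - (l ord0 j / dotp l l) *: l.
have lv : dotp l v = 0 by rewrite dotpDr dotpNr dotpZr dotpC dotp_delta divfK// subrr.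
have cg : continuous (fun y : R => expR (beta * y)).
  by apply/continuousR_expR/continuousR_scale => y; exact: cvg_id.
have := integral_orth_odd cK muK rmu cg lv.
rewrite (eq_Rintegral_rV _ (g := fun x : 'rV[R]_m => x ord0 j * expR (beta * dotp l x) +
  (- (l ord0 j / dotp l l)) * (dotp l x * expR (beta * dotp l x)))); last first.
  by move=> x; rewrite dotpDl dotpNl dotpZl dotp_delta; ring.
have cM : continuous (fun x : 'rV[R]_m => dotp l x * expR (beta * dotp l x)).
  exact: continuousR_mul.
rewrite (Rintegral_compactD cK muK); last 2 first.
- by apply: continuousR_mul => // x; exact: coord_continuous.
- exact: continuousR_scale.
rewrite (Rintegral_compactZ cK muK)// mulNr => /eqP; rewrite subr_eq0 => /eqP ->.
by rewrite -/(M l); ring.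
Qed.

(** With E the polynomial 1 + a_1 + a_3 u + ..., the remainder r satisfies
    u G r = M - u G E.  Replacing G and M by their Taylor polynomials costs
    O(u^(n+1)), and what is left is a polynomial in u whose coefficients up to
    order n vanish by hypothesis. *)
Lemma Phi_expansion_of_moments n (a : nat -> R) : (0 < n)%N ->
  (forall k, (k < n)%N ->
     (k.+1.*2)%:R / beta * g k.+1 =
     \sum_(j < k.+1) g (k - j) * (a (2 * j + 1)%N + (j == 0 :> nat)%:R)) ->
  Phi_expansion mu beta n a.
Proof.
move=> n_gt0 rec.
pose e j := a (2 * j + 1)%N + (j == 0)%:R.
pose Gp := \poly_(k < n.+1) g k.
pose Mp := \poly_(k < n.+1) ((k.*2)%:R / beta * g k).
pose Ep := \poly_(j < n) e j.
have [cQ cQ0 HQ] : exists2 c, 0 <= c & forall u, 0 <= u <= 1 ->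
    `|(Mp - 'X * (Gp * Ep)).[u]| <= c * u ^+ n.+1.
  apply: poly_vanishing_bound => -[|k] kn.
    by rewrite coefB coefXM coef_poly /= !mul0r subr0.
  rewrite coefB coefXM coef_poly/= ltnS kn rec// coefMr; apply/eqP; rewrite subr_eq0.
  apply/eqP; apply: eq_bigr => j _; rewrite !coef_poly.
  by rewrite (leq_ltn_trans (leq_subr _ _)) ?ltnS ?(ltnW kn)// (leq_trans (ltn_ord j) kn).
have [cG cG0 HG] := G_expansion n.
have [cM cM0 HM] := M_expansion n.
pose cE := \sum_(j < n) `|e j|.
have HE u : 0 <= u <= 1 -> `|Ep.[u]| <= cE.
  move=> /andP[u0 u1]; rewrite horner_poly; apply: le_trans (ler_norm_sum _ _ _) _.
  apply: ler_sum => j _; rewrite normrM ler_piMr// ger0_norm ?exprn_ge0//.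
  exact: exprn_ile1.
(* The value at 0 is immaterial for the equation but must vanish for the bound. *)
pose r l := if l == 0 then 0 else M l / (dotp l l * G l) - Ep.[dotp l l].
have G_gt0 l : 0 < G l by rewrite (lt_le_trans ltr01)// G_ge1.
exists r; last first.
  near=> l; apply/rowP => j; rewrite !mxE.
  have [->|l0] := eqVneq l 0.
    rewrite mxE mulr0 subr0.
    rewrite (eq_Rintegral_rV _
      (g := fun x : 'rV[R]_m => dotp (delta_mx ord0 j) x ^+ 1)).
      by rewrite (integral_dotp_odd cK muK rmu)// mul0r.
    move=> x; rewrite -(scale0r 0) dotpZl mul0r mulr0 expR0 mulr1 expr1.
    by rewrite dotp_delta.
  rewrite Phi_coordE// -/(G l) /r (negbTE l0).
  have u0 : dotp l l != 0 by rewrite dotp_eq0.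
  have n0 : G l != 0 by rewrite gt_eqF.
  suff -> : \sum_(1 <= k < n.+1) a (2 * k - 1)%N * enorm l ^+ (2 * k - 2) =
      Ep.[dotp l l] - 1.
    by field; rewrite ?u0 ?n0.
  rewrite /Ep big_add1/= -(prednK n_gt0)/= big_mkord horner_poly.
  rewrite !big_ord_recl /= expr0 mulr1 addrAC; congr (_ + _).
    by rewrite /e eqxx addrK muln1 subnn expr0 mulr1.
  apply: eq_bigr => i _; rewrite /e addr0; congr (a _ * _).
    by rewrite mulnS addnC -addnBA.
  by rewrite mulnS addKn mul2n enorm_exp.
apply/eqO_exP; exists (cM + cG * cE + cQ + 1).
  by rewrite ltr_wpDl// !addr_ge0// mulr_ge0// sumr_ge0.
have : \forall l \near (0 : 'rV[R]_m), dotp l l < 1.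
  apply: (@continuous_sqnorm R m 0 [set y | y < 1]); apply: open_nbhs_nbhs; split.
    exact: open_lt.
  by rewrite /= -(scale0r 0) dotpZl mul0r.
apply: filterS => l l1; have {}l1 := ltW l1.
rewrite /r; case: eqVneq => [_|l0].
  by rewrite normr0 mulr_ge0// !addr_ge0// mulr_ge0// sumr_ge0.
have u_gt0 : 0 < dotp l l by rewrite dotp_gt0.
have u01 : 0 <= dotp l l <= 1 by rewrite ltW.
rewrite mul2n enorm_exp (ger0_norm (exprn_ge0 n (ltW u_gt0))).
set u := dotp l l in l1 u_gt0 u01 *.
have uG : 0 < u * G l by rewrite mulr_gt0.
rewrite -(ler_pM2l u_gt0); apply: (@le_trans _ _ (u * G l * `|M l / (u * G l) - Ep.[u]|)).
  by rewrite -mulrA ler_pM2l// ler_peMl// G_ge1.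
rewrite -[X in X * _](gtr0_norm uG) -normrM mulrBr [u * G l * (_ / _)]mulrC divfK ?gt_eqF//.
have -> : M l - u * G l * Ep.[u] = (M l - Mp.[u]) - u * Ep.[u] * (G l - Gp.[u])
    + (Mp - 'X * (Gp * Ep)).[u].
  rewrite hornerD hornerN !hornerM hornerX.
  move: (M l) (G l) (Gp.[u]) (Mp.[u]) (Ep.[u]) => *; ring.
have HM' : `|M l - Mp.[u]| <= cM * u ^+ n.+1.
  by have := HM l l1; rewrite big_mkord /Mp horner_poly.
have HG' : `|G l - Gp.[u]| <= cG * u ^+ n.+1.
  by have := HG l l1; rewrite big_mkord /Gp horner_poly.
apply: le_trans (ler_normD _ _) _.
rewrite [leRHS](_ : _ = cM * u ^+ n.+1 + cG * cE * u ^+ n.+1 + cQ * u ^+ n.+1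
  + u ^+ n.+1); last by rewrite exprS; ring.
rewrite -[leLHS]addr0; apply: lerD; last by rewrite exprn_ge0// ltW.
apply: lerD; last exact: HQ.
apply: le_trans (ler_normB _ _) _; apply: lerD => //.
rewrite normrM mulrAC mulrC; apply: ler_pM => //.
rewrite normrM gtr0_norm// -[leRHS]mul1r.
by apply: ler_pM => //; [exact: ltW|exact: HE].
Unshelve. all: by end_near. Qed.

End Phi_expansion_of_moments.

(** * Laplacian and Wick powers of odd radial monomials *)

Section wick.
Context (R : realType) (m : nat).
Local Notation X j := (varX R j).
Local Notation S := (sqnormX R m).

Lemma mderiv_varX (i j : 'I_m) : mderiv i (X j) = (i == j)%:R.
Proof.
rewrite /varX mderivX mnm1E eq_sym; case: eqP => [->|_]; last by rewrite scale0r.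
rewrite (_ : mnm_sub (mnm1 j) (mnm1 j) = mnm0) ?mpolyX0 ?scale1r//.
by apply/mnmP => k; rewrite mnmBE subnn mnm0E.
Qed.

Lemma mderiv_exp (i : 'I_m) (q : mpoly m R) k :
  mderiv i (q ^+ k) = k%:R *: (q ^+ k.-1 * mderiv i q).
Proof.
elim: k => [|k IH]; first by rewrite expr0 scale0r -mpolyC1 mderivC.
rewrite exprS mderivM IH /=; case: k {IH} => [|k].
  by rewrite scale0r mulr0 addr0 expr0 !mulr1 mul1r scale1r.
rewrite -scalerAr mulrA -exprS mulrC.
by rewrite -[k.+2%:R]natr1 scalerDl scale1r addrC mulrC.
Qed.

Lemma mderiv_sqnorm (i : 'I_m) : mderiv i S = 2 *: X i.
Proof.
rewrite /sqnormX raddf_sum (bigD1 i)//= big1 => [|j ji].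
  by rewrite mderiv_exp mderiv_varX eqxx mulr1 addr0.
by rewrite mderiv_exp mderiv_varX eq_sym (negbTE ji) mulr0 scaler0.
Qed.

Lemma laplacian_sqnorm_exp p :
  laplacian (S ^+ p.+1) = (p.+1.*2 * (m + p.*2))%:R *: (S ^+ p).
Proof.
have d1 i : mderiv i (S ^+ p.+1) = (p.+1.*2)%:R *: (X i * S ^+ p).
  by rewrite mderiv_exp mderiv_sqnorm -scalerAr scalerA -natrM muln2 mulrC.
have d2 i : mderiv i (mderiv i (S ^+ p.+1)) =
    (p.+1.*2)%:R *: (S ^+ p + (p.*2)%:R *: (X i ^+ 2 * S ^+ p.-1)).
  rewrite d1 linearZ/= mderivM mderiv_varX eqxx mul1r; congr (_ *: (_ + _)).
  rewrite mderiv_exp mderiv_sqnorm -!scalerAr scalerA -natrM muln2.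
  by congr (_ *: _); rewrite expr2 -!mulrA; congr (_ * _); exact: mulrC.
rewrite /laplacian (eq_bigr _ (fun i _ => d2 i)) -scaler_sumr big_split/=.
rewrite sumr_const card_ord -scaler_sumr -mulr_suml -/(sqnormX R m).
rewrite natrM -scalerA; congr (_ *: _); rewrite natrD scalerDl scaler_nat.
rewrite !scaler_nat; congr (_ + _).
by case: p {d1 d2} => [|p]; rewrite ?mulr0n//= -exprS.
Qed.

Lemma laplacian_varX_mul (j : 'I_m) (q : mpoly m R) :
  laplacian (X j * q) = 2 *: mderiv j q + X j * laplacian q.
Proof.
rewrite /laplacian (eq_bigr (fun i => 2 *: ((i == j)%:R * mderiv i q) +
   X j * mderiv i (mderiv i q))) => [|i _].
  rewrite big_split/= -mulr_sumr -scaler_sumr (bigD1 j)//= eqxx mul1r.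
  by rewrite big1 ?addr0// => i ij; rewrite (negbTE ij) mul0r.
rewrite mderivM mderiv_varX raddfD/= !mderivM mderiv_varX.
have -> : mderiv i ((i == j)%:R : mpoly m R) = 0.
  by case: (i == j); rewrite ?mderiv0// -mpolyC1 mderivC.
by rewrite mul0r add0r addrA scaler_nat mulr2n.
Qed.

Lemma laplacian_varX_sqnorm (j : 'I_m) p :
  laplacian (X j * S ^+ p) = (p.*2 * (p.*2 + m))%:R *: (X j * S ^+ p.-1).
Proof.
rewrite laplacian_varX_mul mderiv_exp mderiv_sqnorm -!scalerAr !scalerA.
case: p => [|p].
  rewrite mulr0 mul0r !scale0r add0r.
  rewrite expr0 /laplacian big1 ?mulr0// => i _.
  by rewrite -mpolyC1 mderivC mderiv0.
rewrite laplacian_sqnorm_exp -scalerAr [S ^+ _ * _]mulrC -scalerDl.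
by congr (_ *: _); rewrite -!natrM -natrD; congr (_%:R); lia.
Qed.

(** The factor of index i = p vanishes, so that the truncated subtraction p - l
    in iter_laplacian is harmless for l > p. *)
Definition lap_coef p l : nat := \prod_(i < l) ((p - i).*2 * ((p - i).*2 + m)).

Lemma iter_laplacian (j : 'I_m) p l :
  iter l (@laplacian R m) (X j * S ^+ p) = (lap_coef p l)%:R *: (X j * S ^+ (p - l)).
Proof.
elim: l => [|l IH]; first by rewrite /lap_coef big_ord0 scale1r subn0.
rewrite iterS IH.
have -> : laplacian ((lap_coef p l)%:R *: (X j * S ^+ (p - l))) =
    (lap_coef p l)%:R *: laplacian (X j * S ^+ (p - l)).
  rewrite /laplacian scaler_sumr; apply: eq_bigr => i _.
  by rewrite !linearZ.
by rewrite laplacian_varX_sqnorm scalerA -natrM /lap_coef big_ord_recr/= subnS.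
Qed.

Lemma lap_coef_gt p l : (p < l)%N -> lap_coef p l = 0%N.
Proof.
by move=> pl; rewrite /lap_coef (bigD1 (Ordinal pl))//= subnn !mul0n.
Qed.

(** Hence the sum defining H contains all the non-zero iterated Laplacians. *)
Lemma msize_varX_sqnorm (j : 'I_m) p : (p.+1 <= msize (X j * S ^+ p))%N.
Proof.
have ej : meval (fun i => (i == j)%:R : R) S = 1.
  rewrite /sqnormX raddf_sum/= (bigD1 j)//= big1 => [|i ij].
    by rewrite addr0 rmorphXn/= /varX mevalXU eqxx expr1n.
  by rewrite rmorphXn/= /varX mevalXU (negbTE ij) expr0n.
have S0 : S != 0.
  by apply/eqP => S0; move: ej; rewrite S0 meval0 => /eqP; rewrite eq_sym oner_eq0.
have X0 : X j != 0.
  apply/eqP => X0; have := mevalXU (fun i : 'I_m => 1 : R) j.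
  by rewrite -[mpolyX _ _]/(varX R j) X0 meval0 => /eqP; rewrite eq_sym oner_eq0.
have S2 : (2 <= msize S)%N.
  rewrite leqNgt; apply/negP; rewrite ltnS => /msize1_polyC SC.
  have : meval (fun=> 0 : R) S = 0.
    rewrite /sqnormX raddf_sum/= big1// => i _.
    by rewrite rmorphXn/= /varX mevalXU expr0n.
  move: ej; rewrite SC !mevalC => -> /eqP; by rewrite oner_eq0.
have Sp : (p.+1 <= msize (S ^+ p))%N.
  elim: p => [|p IH]; first by rewrite expr0 msize1.
  rewrite exprS msizeM ?expf_neq0//.
  move: S2 IH; case: (msize S) => [//|[//|s]] _ h.
  by rewrite !addSn/= ltnS (leq_trans h)// leq_addl.
rewrite msizeM ?expf_neq0// {1}/varX msizeX mdeg1 addSn/=.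
by apply: (leq_trans Sp); rewrite add1n leqnSn.
Qed.

Lemma wick_varX_sqnorm (j : 'I_m) p c :
  H (X j * S ^+ p) c = X j * \sum_(0 <= q < p.+1)
    ((- (c / 2)) ^+ (p - q) / ((p - q)`!)%:R * (lap_coef p (p - q))%:R) *: S ^+ q.
Proof.
rewrite /H (big_cat_nat _ (msize_varX_sqnorm j p))//=.
rewrite [Y in _ + Y]big_nat [Y in _ + Y]big1 => [|l /andP[pl _]]; last first.
  by rewrite iter_laplacian lap_coef_gt// scale0r scaler0.
rewrite addr0 big_nat_rev/= mulr_sumr; apply: eq_big_nat => q /andP[_ qp].
rewrite add0n subSS iter_laplacian subKn -1?ltnS//.
by rewrite scalerA scalerAr.
Qed.

(** The coefficient of X_j |X|^(2q) in the combination of the Wick powers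
    H(X_j |X|^(2p), c) with coefficients a_(2p+1). *)
Definition wick_coef n (a : nat -> R) c q : R :=
  \sum_(0 <= p < n | (q <= p)%N) a (2 * p + 1)%N *
    ((- (c / 2)) ^+ (p - q) / ((p - q)`!)%:R * (lap_coef p (p - q))%:R).

Lemma wick_combination n (a : nat -> R) c (j : 'I_m) : (0 < n)%N ->
  a 1%N *: X j + \sum_(2 <= k < n.+1) a (2 * k - 1)%N *: H (X j * S ^+ (k - 1)) c =
  X j * \sum_(0 <= q < n) wick_coef n a c q *: S ^+ q.
Proof.
move=> n0.
transitivity (\sum_(0 <= p < n) a (2 * p + 1)%N *: H (X j * S ^+ p) c).
  rewrite [RHS]big_ltn//= muln0 add0n; congr (_ + _).
    rewrite expr0 mulr1; have := wick_varX_sqnorm j 0 c.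
    rewrite expr0 mulr1 => ->; rewrite big_nat1 expr0 subnn/= expr0 fact0.
    by rewrite /lap_coef big_ord0 divr1 mulr1 scale1r mulr1.
  rewrite big_add1/=; apply: eq_big_nat => k /andP[k1 _].
  by rewrite !subn1 mulnS add2n addn1.
under eq_bigr do rewrite wick_varX_sqnorm scalerAr scaler_sumr.
rewrite -mulr_sumr; congr (_ * _).
under eq_big_nat => p /andP[_ pn] do rewrite (big_nat_widen _ _ _ _ _ pn)/=.
rewrite (exchange_big_dep_nat xpredT)//=; apply: eq_bigr => q _.
rewrite /wick_coef scaler_suml; apply: eq_big => [p|p _]; first by rewrite ltnS.
by rewrite scalerA.
Qed.

End wick.

(** * The coefficients and moments to be realised *)

Lemma near_at_right0 (R : realType) (P : R -> Prop) :
  (\forall g \near 0^'+, P g) -> exists2 e, 0 < e & forall g, 0 < g < e -> P g.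
Proof.
move=> /nbhs_ballP[e /= e0 eP]; exists e => // g /andP[g0 ge].
by apply: eP => //; rewrite /ball/= sub0r normrN gtr0_norm.
Qed.

Lemma exprn_fact_le_expR (R : realType) (s : R) k : 0 <= s ->
  s ^+ k <= k`!%:R * expR s.
Proof.
move=> s0; rewrite mulrC -ler_pdivrMr ?ltr0n ?fact_gt0//.
apply: le_trans (expR_partial_le k.+1 s0).
rewrite big_nat_recr//= lerDr; apply: sumr_ge0 => i _.
by rewrite mulr_ge0 ?exprn_ge0// invr_ge0.
Qed.

Section logarithmic_divergence.
Context (R : realType) (m : nat) (C : R -> R).
Hypothesis C_gt0 : forall g, 0 < g -> 0 < C g.
Hypothesis C_log : diverges_log C.

(** With s = ln (1 / g), one has g = exp (- s) and s^k <= k! exp s. *)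
Lemma cvg_sqr_mul_log_exp k : g ^+ 2 * C g ^+ k @[g --> 0^'+] --> (0 : R).
Proof.
have [c [c' [c0 cc' H]]] := C_log.
have c'0 : 0 <= c' by rewrite (le_trans (ltW c0)).
have idc : g @[g --> (0:R)^'+] --> (0 : R) by exact: cvg_at_right_filter.
have up : c' ^+ k * k`!%:R * g @[g --> 0^'+] --> (0 : R).
  by rewrite -[X in _ --> X](mulr0 (c' ^+ k * k`!%:R)); exact: cvgMr.
apply: (squeeze_cvgr _ (cvg_cst 0) up).
near=> g.
have g0 : 0 < g by near: g; exact: nbhs_right_gt.
have g1 : g < 1 by near: g; exact: nbhs_right_lt.
have gV1 : 1 <= g^-1 by rewrite invf_ge1// ltW.
have s0 : 0 <= ln g^-1 by rewrite ln_ge0.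
have Cg0 := C_gt0 g0.
apply/andP; split; first by rewrite mulr_ge0// exprn_ge0// ltW.
have CH : C g <= c' * ln g^-1.
  have : c * ln g^-1 <= C g <= c' * ln g^-1 by near: g.
  by move=> /andP[].
have Ck : C g ^+ k <= (c' * ln g^-1) ^+ k.
  by apply: lerXn2r => //; rewrite nnegrE ltW// (lt_le_trans Cg0).
have := exprn_fact_le_expR k s0; rewrite lnK ?posrE ?invr_gt0// => Lk.
apply: (@le_trans _ _ (g ^+ 2 * (c' ^+ k * (k`!%:R * g^-1)))).
  rewrite ler_pM2l ?exprn_gt0//; apply: le_trans Ck _.
  by rewrite exprMn ler_wpM2l// exprn_ge0.
rewrite le_eqVlt; apply/orP; left; apply/eqP; field.
by rewrite gt_eqF.
Unshelve. all: by end_near. Qed.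

Lemma cvg_wick_coef n (a : nat -> R) q : (q.+1 < n)%N ->
  g ^+ (2 * n - (2 * q).+2) * wick_coef m n a (C g) q @[g --> 0^'+] --> (0 : R).
Proof.
move=> qn; have idc : g @[g --> (0:R)^'+] --> (0 : R) by exact: cvg_at_right_filter.
pose F p g : R := (a (2 * p + 1)%N * ((- 2^-1) ^+ (p - q) / ((p - q)`!)%:R *
   (lap_coef m p (p - q))%:R)) * (g ^+ (2 * n - (2 * q).+4) * (g ^+ 2 * C g ^+ (p - q))).
have Fp p : F p g @[g --> (0:R)^'+] --> (0 : R).
  rewrite -[X in _ --> X](mulr0 (a (2 * p + 1)%N * ((- 2^-1) ^+ (p - q) /
    ((p - q)`!)%:R * (lap_coef m p (p - q))%:R))); apply: cvgMr.
  rewrite -[X in _ --> X](mulr0 (0 ^+ (2 * n - (2 * q).+4))).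
  apply: cvgM; last exact: cvg_sqr_mul_log_exp.
  have cX : continuous (fun y : R => y ^+ (2 * n - (2 * q).+4)).
    by apply: continuousR_exp => y; exact: cvg_id.
  exact: (cvg_comp _ _ idc (cX 0)).
have : \sum_(0 <= p < n | (q <= p)%N) F p g @[g --> (0:R)^'+] -->
    \sum_(0 <= p < n | (q <= p)%N) (0 : R) by apply: cvg_sumr => p _.
rewrite big1// => HF.
rewrite (_ : (fun g => _) = (fun g => \sum_(0 <= p < n | (q <= p)%N) F p g))//.
apply/funext => g; rewrite /wick_coef mulr_sumr; apply: eq_bigr => p _.
rewrite /F [in LHS](_ : (2 * n - (2 * q).+2)%N = (2 * n - (2 * q).+4 + 2)%N); last by lia.
have -> : (- (C g / 2)) ^+ (p - q) = (- 2^-1) ^+ (p - q) * C g ^+ (p - q).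
  by rewrite -exprMn; congr (_ ^+ _); ring.
rewrite exprD; move: (g ^+ (2 * n - (2 * q).+4)) ((- 2^-1) ^+ (p - q)) => A B.
by move: (C g ^+ (p - q)) => D; ring.
Qed.

Lemma wick_coef_last n (a : nat -> R) c : wick_coef m n.+1 a c n = a (2 * n + 1)%N.
Proof.
rewrite /wick_coef big_mkcond big_nat_recr//= leqnn subnn expr0 fact0 divr1 mul1r.
rewrite /lap_coef big_ord0 mulr1 big_nat big1 ?add0r// => p /andP[_ pn].
by rewrite leqNgt pn.
Qed.

End logarithmic_divergence.

(** The Taylor coefficients of the solution of (2 / beta) G' = (e_0 + e_1 u + ...) G
    with G(0) = 1. *)
Section moment_recursion.
Variable R : realType.
Implicit Types (beta : R) (e : nat -> R).

(** Course-of-values recursion: the list of the coefficients found so far is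
    extended by the next one. *)
Definition next_taylor beta e (s : seq R) : seq R :=
  rcons s (beta / ((size s).*2)%:R * \sum_(j < size s) s`_(size s - j.+1) * e j).

Definition taylor_coef beta e k : R := (iter k (next_taylor beta e) [:: 1])`_k.

Lemma taylor_coef0 beta e : taylor_coef beta e 0 = 1. Proof. by []. Qed.

Lemma taylor_coefS beta e k : taylor_coef beta e k.+1 =
  beta / (k.+1.*2)%:R * \sum_(j < k.+1) taylor_coef beta e (k - j) * e j.
Proof.
have sz l : size (iter l (next_taylor beta e) [:: 1]) = l.+1.
  by elim: l => // l IH; rewrite iterS size_rcons IH.
have st l i : (i <= l)%N -> (iter l (next_taylor beta e) [:: 1])`_i = taylor_coef beta e i.
  elim: l => [|l IH]; first by case: i.
  rewrite leq_eqVlt => /predU1P[->//|il].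
  by rewrite iterS /next_taylor nth_rcons sz il IH.
rewrite {1}/taylor_coef iterS /next_taylor nth_rcons sz ltnn eqxx.
by congr (_ * _); apply: eq_bigr => j _; rewrite subSS st ?leq_subr.
Qed.

Lemma cvg_taylor_coef (T : Type) (F : set_system T) {FF : Filter F} (n : nat)
    (beta : T -> R) (e : T -> nat -> R) (b : R) (e0 : nat -> R) :
  beta g @[g --> F] --> b ->
  (forall j, (j < n)%N -> e g j @[g --> F] --> e0 j) ->
  forall k, (k <= n)%N ->
    taylor_coef (beta g) (e g) k @[g --> F] --> taylor_coef b e0 k.
Proof.
move=> cb ce k; elim/ltn_ind: k => -[|k] IH kn; first exact: cvg_cst.
under eq_cvg do rewrite taylor_coefS; rewrite taylor_coefS.
apply: cvgM; first exact: cvgMl.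
apply: cvg_sumr => j _; apply: cvgM.
  by apply: IH; rewrite ?ltnS ?leq_subr// (leq_trans (leq_subr _ _))// ltnW.
by apply: ce; apply: leq_trans kn; exact: ltn_ord.
Qed.

Lemma taylor_coef_eq beta e e' k : (forall j, (j < k)%N -> e j = e' j) ->
  taylor_coef beta e k = taylor_coef beta e' k.
Proof.
elim/ltn_ind: k => -[//|k] IH ee'; rewrite !taylor_coefS; congr (_ * _).
apply: eq_bigr => j _; rewrite ee'; last exact: ltn_ord.
congr (_ * _); apply: IH; first by rewrite ltnS leq_subr.
by move=> i ik; apply: ee'; rewrite (leq_trans ik)// (leq_trans (leq_subr _ _)).
Qed.

Lemma taylor_coef_gauss beta k :
  taylor_coef beta (fun j => (j == 0)%:R) k = (beta / 2) ^+ k / k`!%:R.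
Proof.
elim: k => [|k IH]; first by rewrite expr0 fact0 divr1.
rewrite taylor_coefS big_ord_recl/= mulr1 subn0 IH big1 => [|j _]; last by rewrite mulr0.
have k0 : k.+1%:R != 0 :> R by rewrite pnatr_eq0.
have f0 : k`!%:R != 0 :> R by rewrite pnatr_eq0 -lt0n fact_gt0.
rewrite addr0 factS natrM exprS -mul2n natrM.
by move: (k.+1%:R) k0 (k`!%:R) f0 => x x0 y y0; field; rewrite x0 y0.
Qed.

(** The perturbation of the last coefficient of the equation is seen only by the
    last Taylor coefficient, and linearly. *)
Lemma taylor_coef_perturbed beta n alpha :
  taylor_coef beta (fun j => (j == 0)%:R + (j == n.+1)%:R * alpha) n.+2 =
  (beta / 2) ^+ n.+2 / (n.+2)`!%:R + beta * alpha / (n.+2.*2)%:R.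
Proof.
rewrite -taylor_coef_gauss [in LHS]taylor_coefS [in RHS]taylor_coefS.
rewrite [in LHS]big_ord_recr [in RHS]big_ord_recr/= subnn taylor_coef0 eqxx.
rewrite !mul1r add0r addr0 mulrDr; congr (_ + _); last by rewrite mulrAC.
congr (_ * _); apply: eq_bigr => j _; rewrite (ltn_eqF (ltn_ord j)) mul0r addr0.
congr (_ * _); apply: taylor_coef_eq => i ij; rewrite (@ltn_eqF i n.+1) ?mul0r ?addr0//.
exact: leq_trans ij (leq_subr _ _).
Qed.

End moment_recursion.

Lemma fact_double k : ((k.*2)`! = 2 ^ k * k`! * \prod_(i < k) i.*2.+1)%N.
Proof.
elim: k => [|k IH]; first by rewrite big_ord0.
rewrite doubleS !factS IH big_ord_recr/= expnS -doubleS -mul2n; ring.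
Qed.

(** * Construction of the family of laws *)

Theorem proposition2p14 (R : realType) (C bg : R -> R) (b : R) (n m : nat)
    (C_gt0 : forall g, 0 < g -> 0 < C g)
    (C_log : diverges_log C)
    (bg_gt0 : forall g, 0 < g -> 0 < bg g)
    (b_gt0 : 0 < b)
    (bg_cvg : bg g @[g --> 0^'+] --> b)
    (n_ge2 : (2 <= n)%N) (m_ge1 : (1 <= m)%N) :
  exists2 delta : R, 0 < delta &
  forall a : nat -> R, - delta < a (2 * n - 1)%N < 0 ->
  exists (g0 : R) (mu : R -> probability (borel_rV R m) R),
    0 < g0 /\
    (forall g, 0 < g < g0 -> rotation_invariant (mu g)) /\
    (forall g, 0 < g < g0 -> exponential_moments (mu g)) /\
    (exists nu : probability (borel_rV R m) R, weakly_converges 0^'+ mu nu) /\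
    (forall g, 0 < g < g0 -> forall j : 'I_m,
       associated_poly (mu g) (bg g) g n j
         (a 1%N *: varX R j
          + \sum_(2 <= k < n.+1)
              a (2 * k - 1)%N *: H (varX R j * sqnormX R m ^+ (k - 1)%N) (C g)))
    /\
    (exists2 K : set 'rV[R]_m, compact K &
       forall g, 0 < g < g0 -> mu g (~` K) = 0%E).
Proof.
pose j0 : 'I_m := Ordinal m_ge1.
have [sigma rs sK] := @sphere_measure_exists R m m_ge1.
case: n n_ge2 => [//|[//|n]] _.
have [N [t [w [psi [t_ge0 w_ge0 wM wpsi]]]]] := dual_quadrature_exists R n.+2 m_ge1.
pose s k := sphere_moment sigma j0 k.*2.
have s_gt0 k : 0 < s k := sphere_moment_gt0 rs sK j0 k.
have sE k : s k * radial_moment R m k = \prod_(i < k) (i.*2.+1)%:R.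
  exact: sphere_moment_prod rs sK j0 k.
pose rad i := Num.sqrt (t i / b).
pose rho := \sum_i rad i.
have rad_rho i : `|rad i| <= rho.
  rewrite ger0_norm ?sqrtr_ge0// /rho (bigD1 i)//= lerDl.
  by apply: sumr_ge0 => l _; exact: sqrtr_ge0.
have rho_ge0 : 0 <= rho by apply: sumr_ge0 => l _; exact: sqrtr_ge0.
have /choice[MU MUP] : forall v : 'I_N -> R, exists mu : probability (borel_rV R m) R,
    (forall i, 0 <= v i) -> \sum_i v i = 1 ->
  [/\ rotation_invariant mu, mu (~` @euclid_ball R m rho) = 0%E &
    forall f : 'rV[R]_m -> R, continuous f ->
      \int[mu]_x f x = \sum_i v i * \int[sigma]_x f (rad i *: (x : 'rV[R]_m))].
  move=> v; have [[v0 v1]|nv] := pselect ((forall i, 0 <= v i) /\ \sum_i v i = 1).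
    by have [mu Hmu] := mixture_exists rs sK v0 v1 rad_rho; exists mu.
  by exists sigma => v0 v1; exfalso; apply: nv.
(* The moment of order k of the squared nodes t_i that corresponds to the Taylor
   coefficient x of G at the inverse temperature beta is kap beta k * x. *)
pose kap (beta : R) k : R := b ^+ k * (k.*2)`!%:R / (beta ^+ k.*2 * s k).
have kap_gauss k : kap b k * ((b / 2) ^+ k / k`!%:R) = radial_moment R m k.
  have f0 : k`!%:R != 0 :> R by rewrite pnatr_eq0 -lt0n fact_gt0.
  have sk0 : s k != 0 by rewrite gt_eqF.
  have bk0 : b ^+ k != 0 by rewrite expf_neq0// gt_eqF.
  have p0 : (2 : R) ^+ k != 0 by rewrite expf_neq0.
  rewrite /kap fact_double !natrM natr_prod -sE natrX expr_div_n -addnn exprD.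
  move: (b ^+ k) bk0 (s k) sk0 (2 ^+ k) p0 (k`!%:R) f0 => x x0 y y0 z z0 u u0.
  by field; rewrite x0 y0 z0 u0.
(* D * alpha is the limit deviation of the last moment; delta makes the relative
   change of every weight that it causes smaller than 1. *)
pose D := kap b n.+2 * (b / (n.+2.*2)%:R).
have D_ge0 : 0 <= D.
  apply: mulr_ge0; last by rewrite divr_ge0// ltW.
  by apply: divr_ge0; apply: mulr_ge0; rewrite ?exprn_ge0 ?ler0n// ltW.
pose Psi := \sum_i `|psi ord_max i|.
have Psi_ge0 : 0 <= Psi by apply: sumr_ge0.
have DPsi : 0 < 1 + D * Psi by rewrite ltr_pwDl// mulr_ge0.
exists (1 + D * Psi)^-1; first by rewrite invr_gt0.
move=> a; set alpha := a _ => /andP[alpha_gt alpha_lt].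
have alphaE : alpha = a (2 * n.+1 + 1)%N by rewrite /alpha; congr a; lia.
pose e g j := g ^+ (2 * n.+2 - (2 * j).+2) * wick_coef m n.+2 a (C g) j + (j == 0)%:R.
pose e0 j : R := (j == 0)%:R + (j == n.+1)%:R * alpha.
have ce j : (j < n.+2)%N -> e g j @[g --> 0^'+] --> e0 j.
  rewrite /e0 addrC ltnS leq_eqVlt => /predU1P[->|jn].
    rewrite eqxx mul1r; apply: cvgD; last exact: cvg_cst.
    rewrite (_ : (fun g => _) = fun=> alpha); first exact: cvg_cst.
    apply/funext => g; rewrite wick_coef_last -alphaE (_ : (_ - _)%N = 0%N) ?mul1r//.
    lia.
  rewrite (ltn_eqF jn) mul0r; apply: cvgD; last exact: cvg_cst.
  exact: cvg_wick_coef.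
(* Deviation of the moments to be realised from the Gaussian ones, and its
   limit. *)
pose dlt g k := kap (bg g) k * taylor_coef (bg g) (e g) k - radial_moment R m k.
pose dlt0 k := kap b k * taylor_coef b e0 k - radial_moment R m k.
have cX k : bg g ^+ k @[g --> 0^'+] --> b ^+ k.
  have cX : continuous (fun y : R => y ^+ k) by apply: continuousR_exp => y; exact: cvg_id.
  exact: (cvg_comp _ _ bg_cvg (cX b)).
have cdlt k : (k <= n.+2)%N -> dlt g k @[g --> 0^'+] --> dlt0 k.
  move=> kn; apply: cvgB; last exact: cvg_cst.
  apply: cvgM; last exact: (cvg_taylor_coef bg_cvg ce kn).
  rewrite /kap; apply: cvgMr; apply: cvgV; last exact: cvgMl.
  by rewrite mulf_neq0 ?expf_neq0 ?gt_eqF.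
have dlt0E k : (k <= n.+2)%N -> dlt0 k = (k == n.+2)%:R * (D * alpha).
  rewrite /dlt0 leq_eqVlt => /predU1P[->|kn].
    rewrite taylor_coef_perturbed mulrDr kap_gauss addrAC subrr add0r eqxx mul1r.
    by rewrite /D; ring.
  rewrite (ltn_eqF kn) mul0r (@taylor_coef_eq _ b e0 (fun j => (j == 0)%:R)).
    by rewrite taylor_coef_gauss kap_gauss subrr.
  by move=> j jk; rewrite /e0 (@ltn_eqF j n.+1) ?mul0r ?addr0// (leq_trans jk).
clearbody D.
pose fac (d : nat -> R) i := 1 + \sum_(k < n.+3) d k * psi k i.
pose W d i := w i * fac d i.
have WE d j : (j <= n.+2)%N -> \sum_i W d i * t i ^+ j = radial_moment R m j + d j.
  move=> jn; rewrite -wM//.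
  transitivity (\sum_i w i * t i ^+ j +
      \sum_i \sum_(k < n.+3) d k * (w i * psi k i * t i ^+ j)).
    rewrite -big_split; apply: eq_bigr => i _; rewrite /W /fac mulrDr mulr1 mulrDl.
    by congr (_ + _); rewrite mulr_sumr mulr_suml; apply: eq_bigr => k _; ring.
  congr (_ + _); rewrite exchange_big/= (bigD1 (inord j))//=.
  rewrite -mulr_sumr.
  have -> : \sum_i w i * psi (inord j) i * t i ^+ j = 1.
    by have := wpsi (inord j) (inord j); rewrite eqxx inordK.
  rewrite inordK// mulr1 big1 ?addr0// => k kj; rewrite -mulr_sumr.
  have := wpsi (inord j) k; rewrite inordK// eq_sym (negbTE kj) => ->.
  by rewrite mulr0.
(* The moment of order 0 is the total mass. *)
have dlt_0 g : 0 < g -> dlt g 0 = 0.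
  move=> g0; rewrite /dlt /kap /radial_moment big_ord0 taylor_coef0 /s sphere_moment0.
  by rewrite !expr0 fact0 !mulr1 divr1 subrr.
pose v g i := W (dlt g) i.
pose v0 i := W dlt0 i.
have cfac i : fac (dlt g) i @[g --> 0^'+] --> fac dlt0 i.
  apply: cvgD; first exact: cvg_cst.
  apply: cvg_sumr => k _; apply: cvgMl; apply: cdlt.
  by rewrite -ltnS ltn_ord.
have fac0_gt0 i : 0 < fac dlt0 i.
  rewrite /fac (bigD1 ord_max)//= dlt0E// eqxx mul1r big1 ?addr0; last first.
    move=> k kn; rewrite dlt0E -1?ltnS//.
    have -> : (k == n.+2 :> nat) = false by apply/negbTE; move: kn; rewrite -val_eqE.
    by rewrite !mul0r.
  have an : `|alpha| < (1 + D * Psi)^-1.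
    by rewrite ltr0_norm// ltrNl.
  have : `|D * alpha * psi ord_max i| < 1.
    rewrite !normrM (ger0_norm D_ge0) mulrAC.
    apply: (@le_lt_trans _ _ (D * Psi * (1 + D * Psi)^-1)).
      apply: ler_pM; rewrite ?mulr_ge0//; last exact: ltW.
      rewrite ler_wpM2l// /Psi (bigD1 i)//= lerDl; exact: sumr_ge0.
    by rewrite ltr_pdivrMr// mul1r ltrDr.
  by rewrite ltr_norml => /andP[h _]; rewrite -ltrBlDl sub0r.
have [g0 g0_gt0 Hg0] : exists2 g0, 0 < g0 & forall g, 0 < g < g0 -> forall i, 0 <= v g i.
  apply: near_at_right0; apply: filter_forall => i.
  have : \forall g \near 0^'+, 0 < fac (dlt g) i.
    apply: (cvgr_gt (fac dlt0 i) (cfac i)); exact: fac0_gt0.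
  by apply: filterS => g fg; rewrite mulr_ge0// ltW.
have v_sum g : 0 < g -> \sum_i v g i = 1.
  move=> g_gt0; have := WE (dlt g) 0%N (leq0n _); rewrite dlt_0// /radial_moment.
  by rewrite big_ord0 addr0 => <-; apply: eq_bigr => i _; rewrite expr0 mulr1.
have v0_ge0 i : 0 <= v0 i by rewrite mulr_ge0// ltW.
have v0_sum : \sum_i v0 i = 1.
  have := WE dlt0 0%N (leq0n _); rewrite dlt0E// mul0r /radial_moment.
  by rewrite big_ord0 addr0 => <-; apply: eq_bigr => i _; rewrite expr0 mulr1.
pose mu g := MU (v g).
have muP g : 0 < g < g0 -> [/\ rotation_invariant (mu g),
    mu g (~` @euclid_ball R m rho) = 0%E &
    forall f : 'rV[R]_m -> R, continuous f ->
      \int[mu g]_x f x = \sum_i v g i * \int[sigma]_x f (rad i *: (x : 'rV[R]_m))].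
  by move=> gg0; apply: MUP; [exact: Hg0|apply: v_sum; case/andP: gg0].
exists g0, mu; split; [by []|split; [|split; [|split; [|split]]]].
- by move=> g /muP[].
- move=> g gg0 theta theta0; have [_ muK _] := muP g gg0.
  have ct : continuous (fun x : 'rV[R]_m => expR (theta * enorm x)).
    by apply/continuousR_expR/continuousR_scale; exact: continuous_enorm.
  by apply: integrable_lty => //; exact: (integrable_compact (@compact_euclid_ball R m rho) muK ct).
- exists (MU v0) => f cf _.
  have [_ _ ->//] := MUP v0 v0_ge0 v0_sum.
  pose c i := \int[sigma]_x f (rad i *: (x : 'rV[R]_m)).
  have cvc : \sum_i v g i * c i @[g --> 0^'+] --> \sum_i v0 i * c i.
    apply: cvg_sumr => i _; apply: cvgMl; apply: cvgMr; exact: cfac.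
  apply: cvg_trans cvc; apply: near_eq_cvg; near=> g.
  have gg0 : 0 < g < g0.
    by apply/andP; split; near: g; [exact: nbhs_right_gt|exact: nbhs_right_lt].
  by have [_ _ ->] := muP g gg0.
- move=> g gg0 j; have g_gt0 : 0 < g by case/andP: gg0.
  have [rmu muK muI] := muP g gg0.
  (* The scaling of the associated polynomial is undone here. *)
pose a' i := g ^+ (2 * n.+2 - i.+1) * wick_coef m n.+2 a (C g) i./2.
  have a'E k : a' (2 * k + 1)%N =
      g ^+ (2 * n.+2 - (2 * k).+2) * wick_coef m n.+2 a (C g) k.
    by rewrite /a' {2}addnC [in X in wick_coef _ _ _ _ X]mul2n (half_bit_double k true) addn1.
  exists a'.
    apply: (Phi_expansion_of_moments rho_ge0 muK rmu (j0 := j0) (bg_gt0 g g_gt0)) => // k kn.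
    have momE l : (l <= n.+2)%N -> bg g ^+ l.*2 *
        \int[mu g]_x ((x : 'rV[R]_m) ord0 j0 ^+ l.*2) / (l.*2)`!%:R =
        taylor_coef (bg g) (e g) l.
      move=> ln; rewrite muI; last by apply: continuousR_exp => x; exact: coord_continuous.
      rewrite (eq_bigr (fun i => (v g i * t i ^+ l) * (s l / b ^+ l))); last first.
        move=> i _; rewrite (eq_Rintegral_rV _ (g := fun x : 'rV[R]_m =>
          rad i ^+ l.*2 * x ord0 j0 ^+ l.*2)) => [|x]; last by rewrite mxE exprMn.
        rewrite (Rintegral_compactZ (@compact_unit_sphere R m) sK); last first.
          by apply: continuousR_exp => x; exact: coord_continuous.
        rewrite -/(sphere_moment _ _ _) -/(s l) -mul2n exprM sqr_sqrtr; last first.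
          by rewrite divr_ge0// ltW.
        by rewrite expr_div_n; ring.
      rewrite -mulr_suml WE// /dlt addrC subrK /kap.
      have b0 : b ^+ l != 0 by rewrite expf_neq0// gt_eqF.
      have B0 : bg g ^+ l.*2 != 0 by rewrite expf_neq0// gt_eqF// bg_gt0.
      have f0 : (l.*2)`!%:R != 0 :> R by rewrite pnatr_eq0 -lt0n fact_gt0.
      have sl0 : s l != 0 by rewrite gt_eqF.
      move: (b ^+ l) b0 (bg g ^+ l.*2) B0 ((l.*2)`!%:R) f0 (s l) sl0.
      by move=> x x0 y y0 z z0 u u0; field; rewrite x0 y0 z0 u0.
    rewrite momE// taylor_coefS.
    have k0 : (k.+1.*2)%:R != 0 :> R by rewrite pnatr_eq0.
    have B0 : bg g != 0 by rewrite gt_eqF// bg_gt0.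
    rewrite mulrA [X in X * _](_ : _ = 1) ?mul1r; last first.
      by rewrite mulrA divfK// divff.
    apply: eq_bigr => i _; rewrite momE; last exact: leq_trans (leq_subr _ _) (ltnW kn).
    by rewrite a'E.
  rewrite wick_combination//; congr (_ * _).
  rewrite [RHS]big_add1/=; apply: eq_big_nat => q /andP[_ qn].
  rewrite (_ : (2 * q.+1 - 1)%N = (2 * q + 1)%N); last by lia.
  rewrite a'E mulrA (_ : (2 * n.+2 - 2 * q.+1)%N = (2 * n.+2 - (2 * q).+2)%N); last by lia.
  by rewrite mulVf ?mul1r ?subn1// expf_neq0// gt_eqF.
- exists (@euclid_ball R m rho); first exact: compact_euclid_ball.
  by move=> g /muP[].
Unshelve. all: by end_near. Qed.
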